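(* Let $\mathcal{M}$ be an $m\times N$ $(K,\alpha)$-coherent matrix. Then all of the following statements hold. 1. Let $\epsilon\in(0,1]$ and $k\in\left[1,\,K\cdot\frac{\epsilon}{4\alpha}\right)\cap\mathbb{N}$. There exists an approximation algorithm based on a modified form of $\mathcal{M}$ (namely $\mathcal{M}\circledast\mathcal{B}_N$), $\Delta_{\mathcal{M}}:\mathbb{C}^{m\lceil\log_2 N\rceil+m}\to\mathbb{C}^N$, which on input $(\mathcal{M}\circledast\mathcal{B}_N)\vec{x}$ is guaranteed to output a vector $\vec{z}_S\in\mathbb{C}^N$ satisfying $$\left\|\vec{x}-\vec{z}_S\right\|_2\le\left\|\vec{x}-\vec{x}^{\rm opt}_k\right\|_2+\frac{22\,\epsilon\left\|\vec{x}-\vec{x}^{\rm opt}_{(k/\epsilon)}\right\|_1}{\sqrt{k}}$$ for all $\vec{x}\in\mathbb{C}^N$. Most importantly, $\Delta_{\mathcal{M}}$ can be evaluated in $O(m\log N)$ time. 2. Define the $m\times N$ matrix $\mathcal{W}$ by normalizing the columns of $\mathcal{M}$ so that $\mathcal{W}_{i,j}=\mathcal{M}_{i,j}/\sqrt{\|\mathcal{M}_{\cdot,j}\|_1}$. Then $\mathcal{W}$ is $\frac{\alpha}{K}$-coherent. 3. Furthermore, the $m\times N$ matrix $\mathcal{W}$ defined in item 2 has the RIP$_2(N,k,(k-1)\alpha/K)$. 4. Define the $m\times N$ matrix $\mathcal{W}$ by $\mathcal{W}_{i,j}=\mathcal{M}_{i,j}/\left(\|\mathcal{M}_{\cdot,j}\|_1\right)^{1/p}$.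 Then $\mathcal{W}$ has the RIP$_p(N,k,C(k-1)\alpha/K)$ for all $1\le p\le 1+\frac{1}{\log N}$, where $C$ is an absolute constant larger than $1/2$. 5. $\mathcal{M}$ is $\lfloor(K-1)/\alpha\rfloor$-disjunct. 6. $\mathcal{M}$ has at least $m=\Omega\left(\min\left\{(K^2/\alpha^2)\log_{K/\alpha}N,\;N\right\}\right)$ rows.
   Context: Columns of an $m\times N$ matrix are indexed by $0,\dots,N-1$; $\mathcal{M}_{\cdot,j}$ denotes the $j$-th column. In items 3 and 4, $k\in\mathbb{N}$ is the sparsity parameter. $(K,\alpha)$-coherent: let $K,\alpha\in[1,m]\cap\mathbb{N}$. A binary matrix $\mathcal{M}\in\{0,1\}^{m\times N}$ is $(K,\alpha)$-coherent if (i) every column contains at least $K$ nonzero entries, and (ii) $\mathcal{M}_{\cdot,j}\cdot\mathcal{M}_{\cdot,l}\le\alpha$ for all $j\ne l$ in $[0,N)$. $\mu$-coherent: let $\mu\in[0,1]$. A complex $m\times N$ matrix is $\mu$-coherent if every column has $\ell^2$-norm $1$ and the inner product of any two distinct columns has absolute value at most $\mu$. RIP$_p(N,k,\epsilon)$, for $p\in[1,\infty)$, $N,k\in\mathbb{N}$, $\epsilon\in(0,1)$: a complex matrix $\mathcal{A}$ with $N$ columns has this property if $(1-\epsilon)\|x\|_p^p\le\|\mathcal{A}x\|_p^p\le(1+\epsilon)\|x\|_p^p$ for all $x\in\mathbb{C}^N$ containing at most $k$ nonzero coordinates. $d$-disjunct: a binary $m\times N$ matrix $\mathcal{M}$ is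 $d$-disjunct if for any subset of $d+1$ of its columns $c_1,\dots,c_{d+1}$ there exists a subset of $d+1$ rows $j_1,\dots,j_{d+1}$ such that the $(d+1)\times(d+1)$ submatrix with $(a,b)$ entry $\mathcal{M}_{j_a,c_b}$ is the identity matrix. Optimal $k$-term approximation: for $\vec{x}\in\mathbb{C}^N$ and an integer $k<N$, $S^{\rm opt}_k\subset\{0,\dots,N-1\}$ is the lexicographically first $k$-element subset with $|x_s|\ge|x_t|$ for all $s\in S^{\rm opt}_k$, $t\notin S^{\rm opt}_k$; $\vec{x}^{\rm opt}_k$ equals $\vec{x}$ on $S^{\rm opt}_k$ and $0$ elsewhere. $\vec{x}^{\rm opt}_{(k/\epsilon)}$ is the same notation with $k/\epsilon$ in place of $k$. Row tensor product and bit test matrix: for $\mathcal{A}\in\mathbb{R}^{m\times N}$, $\mathcal{C}\in\mathbb{R}^{\tilde m\times N}$ (rows indexed from $0$), $\mathcal{A}\circledast\mathcal{C}$ is the $(m\tilde m)\times N$ matrix with $(\mathcal{A}\circledast\mathcal{C})_{i,j}=\mathcal{A}_{i\bmod m,\,j}\cdot\mathcal{C}_{(i-(i\bmod m))/m,\,j}$. The bit test matrix $\mathcal{B}_N$ is the $(1+\lceil\log_2N\rceil)\times N$ matrix whose row $0$ is all ones and whose entry $(i,j)$, for $1\le i\le\lceil\log_2N\rceil$ and $0\le j<N$, is the $(i-1)$-th bit (bit $0$ being the least significant) in the binary expansion of $j$. For the running time in item 1 it is assumed that, for each column $n$, the $K\times N$ submatrix formed by the $K$ rows of $\mathcal{M}$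 with the largest entries in column $n$ is known in advance.
   Formalization: In item 6 the Ω-constant depends on a number r > 1 and the bound is for K/α ≥ r: with α = K−1, m = 2K and all K-subsets as columns no absolute constant works, and log_{K/α} is undefined at K = α. In item 1, k/ε is rounded down and log N is read as at least 1. *)

(* Defs.v *)
From HB Require Import structures.
From mathcomp Require Import all_boot all_order all_algebra.
From mathcomp Require Import all_classical all_reals all_analysis.
From mathcomp Require Import complex.

Set Implicit Arguments.
Unset Strict Implicit.
Unset Printing Implicit Defensive.
Import Order.TTheory GRing.Theory Num.Theory.
Local Open Scope ring_scope.
Local Open Scope complex_scope.

(* [Normc.normc] is the modulus as an element of [R]; the library's [`|z|] on
   [R[i]] is itself an element of [R[i]]. *)
Notation cabs := Normc.normc.

Definition lpnorm (R : realType) (n : nat) (p : R) (x : 'cV[R[i]]_n) : R :=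
  (\sum_i cabs (x i 0) `^ p) `^ p^-1.

Definition nnz (R : realType) (n : nat) (x : 'cV[R[i]]_n) : nat :=
  #|[set i | x i 0 != 0]|.

Definition coherent_bin (m N : nat) (K alpha : nat) (M : 'M[bool]_(m, N)) : Prop :=
  [/\ (1 <= K <= m)%N,
      (1 <= alpha <= m)%N,
      (forall j, (K <= #|[set i | M i j]|)%N) &
      (forall j l, j != l -> (\sum_i M i j * M i l <= alpha)%N)].

(* The predicate is meaningful for every real [mu]; the range [0 <= mu <= 1] is
   not built in. *)
Definition coherent (R : realType) (m N : nat) (mu : R) (A : 'M[R[i]]_(m, N))
    : Prop :=
  (forall j, lpnorm 2 (col j A) = 1) /\
  (forall j l, j != l -> cabs (\sum_i A i j * (A i l)^*) <= mu).

(* As for [coherent], the ranges [1 <= p] and [0 < eps < 1] are not built in. *)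
Definition RIP (R : realType) (m N : nat) (p : R) (k : nat) (eps : R)
    (A : 'M[R[i]]_(m, N)) : Prop :=
  forall x : 'cV[R[i]]_N, (nnz x <= k)%N ->
    (1 - eps) * lpnorm p x `^ p <= lpnorm p (A *m x) `^ p
      <= (1 + eps) * lpnorm p x `^ p.

Definition disjunct (m N : nat) (d : nat) (M : 'M[bool]_(m, N)) : Prop :=
  forall c : 'I_d.+1 -> 'I_N, injective c ->
    exists2 r : 'I_d.+1 -> 'I_m, injective r &
      forall a b, M (r a) (c b) = (a == b).

Definition bin_mx (R : realType) (m N : nat) (M : 'M[bool]_(m, N))
    : 'M[R[i]]_(m, N) := \matrix_(i, j) (M i j)%:R.

Definition col_l1 (R : realType) (m N : nat) (M : 'M[bool]_(m, N)) (j : 'I_N) : R :=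
  lpnorm 1 (col j (bin_mx R M)).

Definition normalize_sqrt (R : realType) (m N : nat) (M : 'M[bool]_(m, N))
    : 'M[R[i]]_(m, N) :=
  \matrix_(i, j) ((M i j)%:R / Num.sqrt (col_l1 R M j))%:C.

Definition normalize_root (R : realType) (m N : nat) (p : R) (M : 'M[bool]_(m, N))
    : 'M[R[i]]_(m, N) :=
  \matrix_(i, j) ((M i j)%:R / col_l1 R M j `^ p^-1)%:C.

Lemma rowmod_subproof (m m' : nat) (i : 'I_(m * m')) : (i %% m < m)%N.
Proof. by rewrite ltn_mod; case: m i => [[i lt_i]|//]; rewrite mul0n in lt_i. Qed.

Lemma rowdiv_subproof (m m' : nat) (i : 'I_(m * m')) : (i %/ m < m')%N.
Proof.
have m_gt0 : (0 < m)%N by case: m i => [[i lt_i]|//]; rewrite mul0n in lt_i.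
by rewrite ltn_divLR // (mulnC m') ltn_ord.
Qed.

Definition row_tensor (S : pzRingType) (m m' N : nat)
    (A : 'M[S]_(m, N)) (B : 'M[S]_(m', N)) : 'M[S]_(m * m', N) :=
  \matrix_(i, j)
    (A (Ordinal (rowmod_subproof i)) j * B (Ordinal (rowdiv_subproof i)) j).

(* [up_log 2 N] is the ceiling of log_2 N for N >= 1. *)
Definition bit_test (S : pzRingType) (N : nat) : 'M[S]_((up_log 2 N).+1, N) :=
  \matrix_(i, j) if i == 0 :> nat then 1 else (odd (j %/ 2 ^ i.-1))%:R.

(* For k >= N the k largest entries are all the entries, hence [minn k N]. *)
Definition is_top (R : realType) (N : nat) (k : nat) (x : 'cV[R[i]]_N)
    (S : {set 'I_N}) : bool :=
  (#|S| == minn k N) &&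
  [forall s in S, forall t in ~: S, cabs (x t 0) <= cabs (x s 0)].

(* [enum] lists a set of ordinals increasingly; two sets of the same size are
   compared through these lists. *)
Definition lex_le (N : nat) (S S' : {set 'I_N}) : bool :=
  ((map val (enum S) : seqlexi nat) <= (map val (enum S') : seqlexi nat))%O.

Definition Sopt (R : realType) (N : nat) (k : nat) (x : 'cV[R[i]]_N) : {set 'I_N} :=
  odflt finset.set0 [pick S | is_top k x S & [forall S', is_top k x S' ==> lex_le S S']].

Lemma SoptP (R : realType) (N : nat) (k : nat) (x : 'cV[R[i]]_N) :
  is_top k x (Sopt k x) /\ (forall S, is_top k x S -> lex_le (Sopt k x) S).
Proof.
have [S0 topS0] : exists S, is_top k x S.
  pose geA := [rel s t : 'I_N | cabs (x t 0) <= cabs (x s 0)].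
  pose l := sort geA (enum 'I_N).
  have ul : uniq l by rewrite sort_uniq enum_uniq.
  exists [set s in take k l]; apply/andP; split.
    rewrite cardsE (card_uniqP _) ?take_uniq // size_take_min size_sort.
    by rewrite size_enum_ord.
  have geA_trans : transitive geA by move=> a b c /= ba ac; apply: le_trans ac ba.
  have : pairwise geA (take k l ++ drop k l).
    rewrite cat_take_drop -sorted_pairwise // sort_sorted // => a b.
    exact: le_total.
  rewrite pairwise_cat => /and3P[/allrelP ge_td _ _].
  apply/forall_inP => s; rewrite inE => s_take.
  apply/forall_inP => t; rewrite !inE => t_take; apply: ge_td => //.
  have : t \in l by rewrite mem_sort mem_enum.
  by rewrite -{1}(cat_take_drop k l) mem_cat (negPf t_take).
rewrite /Sopt; case: pickP => [S /andP[topS /forall_inP minS] //|noS].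
pose key (S : {set 'I_N}) : seqlexi nat := map val (enum S).
have [S topS minS] := @arg_minP _ _ _ S0 (is_top k x) key topS0.
have := noS S; rewrite /= topS => /negP[]; apply/forall_inP => S' topS'.
exact: minS.
Qed.

Definition xopt (R : realType) (N : nat) (k : nat) (x : 'cV[R[i]]_N) : 'cV[R[i]]_N :=
  \col_i if i \in Sopt k x then x i 0 else 0.

(* A unit-cost real random-access machine. Memory is a family of infinite arrays of naturals and a family of infinite
   arrays of reals, all addressed indirectly by naturals. A program is a
   structured command without real constants other than naturals, so that it is
   one finite text independent of the instance; scalars live in array cells.
   Every operation, memory access, comparison and control step costs one. *)

Inductive nexp : Type :=
  | NConst of nat
  | NGet of nat & nexp                (* cell of a natural array *)
  | NAdd of nexp & nexp
  | NSub of nexp & nexp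
  | NMul of nexp & nexp.

Inductive rexp : Type :=
  | RConst of nat
  | RGet of nat & nexp                (* cell of a real array *)
  | RAdd of rexp & rexp
  | RSub of rexp & rexp
  | RMul of rexp & rexp
  | RDiv of rexp & rexp.

Inductive bexp : Type :=
  | NLe of nexp & nexp
  | RLe of rexp & rexp
  | BNot of bexp
  | BAnd of bexp & bexp.

Inductive cmd : Type :=
  | Skip
  | NSet of nat & nexp & nexp         (* natural array, address, value *)
  | RSet of nat & nexp & rexp         (* real array, address, value *)
  | Seq of cmd & cmd
  | If of bexp & cmd & cmd
  | While of bexp & cmd.

Record state (R : realType) := State {
  nmem : nat -> nat -> nat;
  rmem : nat -> nat -> R
}.

Definition upd (T : Type) (mem : nat -> nat -> T) (a i : nat) (v : T)
    : nat -> nat -> T :=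
  fun a' i' => if (a' == a) && (i' == i) then v else mem a' i'.

Fixpoint neval (R : realType) (s : state R) (e : nexp) : nat :=
  match e with
  | NConst n => n
  | NGet a i => nmem s a (neval s i)
  | NAdd e1 e2 => neval s e1 + neval s e2
  | NSub e1 e2 => neval s e1 - neval s e2
  | NMul e1 e2 => neval s e1 * neval s e2
  end%N.

Fixpoint reval (R : realType) (s : state R) (e : rexp) : R :=
  match e with
  | RConst n => n%:R
  | RGet a i => rmem s a (neval s i)
  | RAdd e1 e2 => reval s e1 + reval s e2
  | RSub e1 e2 => reval s e1 - reval s e2
  | RMul e1 e2 => reval s e1 * reval s e2
  | RDiv e1 e2 => reval s e1 / reval s e2
  end.

Fixpoint beval (R : realType) (s : state R) (b : bexp) : bool :=
  match b with
  | NLe e1 e2 => (neval s e1 <= neval s e2)%N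
  | RLe e1 e2 => reval s e1 <= reval s e2
  | BNot b1 => ~~ beval s b1
  | BAnd b1 b2 => beval s b1 && beval s b2
  end.

Fixpoint ncost (e : nexp) : nat :=
  match e with
  | NConst _ => 1
  | NGet _ i => (ncost i).+1
  | NAdd e1 e2 | NSub e1 e2 | NMul e1 e2 => (ncost e1 + ncost e2).+1
  end.

Fixpoint rcost (e : rexp) : nat :=
  match e with
  | RConst _ => 1
  | RGet _ i => (ncost i).+1
  | RAdd e1 e2 | RSub e1 e2 | RMul e1 e2 | RDiv e1 e2 => (rcost e1 + rcost e2).+1
  end.

Fixpoint bcost (b : bexp) : nat :=
  match b with
  | NLe e1 e2 => (ncost e1 + ncost e2).+1
  | RLe e1 e2 => (rcost e1 + rcost e2).+1
  | BNot b1 => (bcost b1).+1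
  | BAnd b1 b2 => (bcost b1 + bcost b2).+1
  end.

(* [exec P s t s']: started in [s], the program [P] halts after [t] steps in [s']. *)
Inductive exec (R : realType) : cmd -> state R -> nat -> state R -> Prop :=
  | ExecSkip s : exec Skip s 1 s
  | ExecNSet a i e s :
      exec (NSet a i e) s (ncost i + ncost e).+1
        (State (upd (nmem s) a (neval s i) (neval s e)) (rmem s))
  | ExecRSet a i e s :
      exec (RSet a i e) s (ncost i + rcost e).+1
        (State (nmem s) (upd (rmem s) a (neval s i) (reval s e)))
  | ExecSeq P Q s t s' t' s'' :
      exec P s t s' -> exec Q s' t' s'' -> exec (Seq P Q) s (t + t') s''
  | ExecIf b P Q s t s' :
      exec (if beval s b then P else Q) s t s' ->
      exec (If b P Q) s (bcost b + t).+1 s'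
  | ExecWhileF b P s :
      ~~ beval s b -> exec (While b P) s (bcost b).+1 s
  | ExecWhileT b P s t s' t' s'' :
      beval s b -> exec P s t s' -> exec (While b P) s' t' s'' ->
      exec (While b P) s (bcost b + t + t').+1 s''.

(* [T a n] is the row index of the [a]-th row of the K x N submatrix formed by K
   rows with the largest entries in column [n]. *)
Definition largest_rows (m N K : nat) (M : 'M[bool]_(m, N)) (T : 'M['I_m]_(K, N))
    : Prop :=
  forall n, injective (fun a => T a n) /\
    (forall a i, (forall b, T b n != i) -> (M i n <= M (T a n) n)%N).

(* Initial memory: natural array 0 holds m, N, K, alpha, k, and natural array 1
   holds [T a n] in cell n * K + a; real arrays 0 and 1 hold the real and
   imaginary parts of the measurements [y], and real array 2 holds [eps] in its
   cell 0. All other cells are 0. *)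
Definition input (R : realType) (m N q : nat) (K alpha k : nat) (eps : R)
    (T : 'M['I_m]_(K, N)) (y : 'cV[R[i]]_q) : state R :=
  State
    (fun a i => match a with
     | 0 => nth 0 [:: m; N; K; alpha; k] i
     | 1 => if (insub (i %/ K), insub (i %% K)) is (Some n, Some b)
            then nat_of_ord (T b n) else 0
     | _ => 0
     end%N)
    (fun a i => match a with
     | 0%N => if insub i is Some j then complex.Re (y j 0) else 0
     | 1%N => if insub i is Some j then complex.Im (y j 0) else 0
     | 2%N => if i == 0%N then eps else 0
     | _ => 0
     end).

(* Real arrays 3 and 4 hold the real and imaginary parts of the result; as they
   are initially 0, only the nonzero coordinates have to be written. The result
   is thus produced in sparse form, possibly in fewer than N steps. *)
Definition output (R : realType) (N : nat) (s : state R) : 'cV[R[i]]_N :=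
  \col_(n < N) (rmem s 3 n +i* rmem s 4 n).

(* Main.v *)
(** Recovery.  Call the l^1 mass of the other coordinates pooled by a row of column
    [n] the noise of that row.  The head of [x], its [k / eps] largest coordinates,
    meets fewer than [K / 4] of the [K] rows of [n], and the remaining mass [tau] is
    counted at most [alpha] times over these rows, so fewer than [5 K / 16] of them
    have noise above [delta = 16 alpha tau / K].  When [|x_n| > delta] a quiet row
    spells [n] in its bit tests, so a majority of rows vote for [n]; and a value that
    has [5 / 16] of the measurements on either side of it is [delta]-close to the
    coordinate.  Exact medians by sorting would cost a factor [log K] that
    [log N] need not dominate.  Instead the data are thinned in linear time: sort blocks of
    size [b], keep every fourth entry, double [b], repeat.  Ranks below a threshold are
    additive over blocks and each block loses at most 3 of them.  Keeping the [2 k] largest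
    estimates is then affordable by repeated maxima, since at most [2 m / K] columns win
    a vote.

    RIP.  In a row where [a] columns of the support meet, the [p]-th power of the modulus
    of the sum differs from the sum of the [p]-th powers by at most [C (a - 1)] times the
    latter, by the power mean inequality if [a >= 2] and trivially if [a = 1]; summing
    over rows turns [a - 1] into inner products of columns.

    Rows.  Columns without common [(alpha + 1)]-subsets give
    [N (K - alpha)^(alpha + 1) <= m^(alpha + 1)], while about [K / 2 alpha] columns
    already cover [K^2 / 4 alpha] rows; the two bounds together exclude a small [m]. *)
Require Import Defs.
From mathcomp Require Import all_boot all_order all_algebra.
From mathcomp Require Import all_classical all_reals all_analysis.
From mathcomp Require Import complex.
From mathcomp Require Import zify ring lra.
Set Implicit Arguments.
Unset Strict Implicit.
Unset Printing Implicit Defensive.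
Import Order.TTheory GRing.Theory Num.Theory.
Local Open Scope ring_scope.
Local Open Scope complex_scope.

(** * Running programs within a budget *)

(** A total-correctness triple with a time limit. Bounding the time from above, instead of fixing
    it, lets budgets be rounded when programs are composed. *)
Definition runs (R : realType) (P : cmd) (s : state R) (T : nat)
    (Q : state R -> Prop) : Prop :=
  exists t s', [/\ exec P s t s', (t <= T)%N & Q s'].

Fixpoint nmods (P : cmd) : seq nat :=
  match P with
  | Skip | RSet _ _ _ => [::]
  | NSet a _ _ => [:: a]
  | Seq P1 P2 | If _ P1 P2 => nmods P1 ++ nmods P2
  | While _ P1 => nmods P1
  end.

Fixpoint rmods (P : cmd) : seq nat :=
  match P with
  | Skip | NSet _ _ _ => [::]
  | RSet a _ _ => [:: a]
  | Seq P1 P2 | If _ P1 P2 => rmods P1 ++ rmods P2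
  | While _ P1 => rmods P1
  end.

Definition frame (R : realType) (P : cmd) (s s' : state R) : Prop :=
  (forall a i, a \notin nmods P -> nmem s' a i = nmem s a i) /\
  (forall a i, a \notin rmods P -> rmem s' a i = rmem s a i).

Lemma frame_trans (R : realType) P (s1 s2 s3 : state R) :
  frame P s1 s2 -> frame P s2 s3 -> frame P s1 s3.
Proof.
move=> [n12 r12] [n23 r23]; split=> a i Pa; first by rewrite n23 ?n12.
by rewrite r23 ?r12.
Qed.

Lemma frame_sub (R : realType) P Q (s s' : state R) :
  {subset nmods P <= nmods Q} -> {subset rmods P <= rmods Q} ->
  frame P s s' -> frame Q s s'.
Proof.
move=> nPQ rPQ [ns rs]; split=> a i Qa.
  by apply: ns; apply: contra Qa => /nPQ.
by apply: rs; apply: contra Qa => /rPQ.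
Qed.

Lemma exec_frame (R : realType) P (s s' : state R) t : exec P s t s' -> frame P s s'.
Proof.
elim=> {P s t s'} //=.
- by move=> a i e s; split=> a' i' //=; rewrite inE /upd => /negPf ->.
- by move=> a i e s; split=> a' i' //=; rewrite inE /upd => /negPf ->.
- move=> P Q s t s' t' s'' _ fP _ fQ.
  apply: (@frame_trans _ _ _ s').
    by apply: frame_sub fP => a /=; rewrite mem_cat => ->.
  by apply: frame_sub fQ => a /=; rewrite mem_cat => ->; rewrite orbT.
- move=> b P Q s t s' _ ; apply: frame_sub => a /=; rewrite mem_cat;
  by case: beval => ->; rewrite ?orbT.
- by move=> b P s t s' t' s'' _ _ fP _; apply: frame_trans.
Qed.

Lemma runs_frame (R : realType) P (s : state R) T Q :
  runs P s T Q -> runs P s T (fun s' => Q s' /\ frame P s s').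
Proof.
move=> [t [s' [Pss' tT Qs']]]; exists t, s'; split=> //; split=> //.
exact: exec_frame Pss'.
Qed.

Lemma runs_weaken (R : realType) P (s : state R) T T' (Q Q' : state R -> Prop) :
  (T <= T')%N -> runs P s T Q -> (forall s', Q s' -> frame P s s' -> Q' s') ->
  runs P s T' Q'.
Proof.
move=> TT' [t [s' [Pss' tT Qs']]] QQ'; exists t, s'; split=> //.
  exact: leq_trans TT'.
exact: QQ' Qs' (exec_frame Pss').
Qed.

Lemma runs_seq (R : realType) P1 P2 (s : state R) T1 T2 (Q1 Q : state R -> Prop) :
  runs P1 s T1 Q1 ->
  (forall s', Q1 s' -> frame P1 s s' -> runs P2 s' T2 Q) ->
  runs (Seq P1 P2) s (T1 + T2) Q.
Proof.
move=> [t1 [s1 [e1 t1T1 Q1s1]]] /(_ s1 Q1s1 (exec_frame e1)) [t2 [s2 [e2 t2T2 Qs2]]].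
exists (t1 + t2)%N, s2; split=> //; last exact: leq_add.
exact: ExecSeq e1 e2.
Qed.

Lemma runs_if (R : realType) b P1 P2 (s : state R) T (Q : state R -> Prop) :
  (beval s b -> runs P1 s T Q) -> (~~ beval s b -> runs P2 s T Q) ->
  runs (If b P1 P2) s (bcost b + T).+1 Q.
Proof.
move=> H1 H2; have [t [s' [e tT Qs']]] : runs (if beval s b then P1 else P2) s T Q.
  by case: ifP => [/H1|/negbT/H2].
exists (bcost b + t).+1, s'; split=> //; first exact: ExecIf.
by rewrite ltnS leq_add2l.
Qed.

Fixpoint loopfree (P : cmd) : bool :=
  match P with
  | Seq P1 P2 | If _ P1 P2 => loopfree P1 && loopfree P2
  | While _ _ => false
  | _ => true
  end.

(** Symbolic evaluation of straight-line code, which turns its verification into simplification.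
    Loops get a dummy value; [loopfree] excludes them. *)
Fixpoint lf_eval (R : realType) (P : cmd) (s : state R) : state R :=
  match P with
  | Skip | While _ _ => s
  | NSet a i e => State (upd (nmem s) a (neval s i) (neval s e)) (rmem s)
  | RSet a i e => State (nmem s) (upd (rmem s) a (neval s i) (reval s e))
  | Seq P1 P2 => lf_eval P2 (lf_eval P1 s)
  | If b P1 P2 => if beval s b then lf_eval P1 s else lf_eval P2 s
  end.

Fixpoint lf_cost (P : cmd) : nat :=
  match P with
  | Skip => 1
  | NSet a i e => (ncost i + ncost e).+1
  | RSet a i e => (ncost i + rcost e).+1
  | Seq P1 P2 => lf_cost P1 + lf_cost P2
  | If b P1 P2 => (bcost b + maxn (lf_cost P1) (lf_cost P2)).+1
  | While _ _ => 0
  end.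

Lemma runs_lf (R : realType) P (s : state R) T (Q : state R -> Prop) :
  loopfree P -> (lf_cost P <= T)%N -> Q (lf_eval P s) -> runs P s T Q.
Proof.
move=> lfP costT QP; apply: (@runs_weaken _ _ _ (lf_cost P) T (eq (lf_eval P s))) => //;
  last by move=> s' <-.
elim: P lfP s {QP costT Q T} => //=.
- by move=> _ s; exists 1, s; split=> //; constructor.
- by move=> a i e _ s; do 2 eexists; split; first exact: ExecNSet.
- by move=> a i e _ s; do 2 eexists; split; first exact: ExecRSet.
- move=> P1 IH1 P2 IH2 /andP[/IH1 {}IH1 /IH2 {}IH2] s.
  by apply: runs_seq (IH1 s) _ => s' <- _.
- move=> b P1 IH1 P2 IH2 /andP[/IH1 {}IH1 /IH2 {}IH2] s; apply: runs_if.
    by move=> ->; apply: runs_weaken (IH1 s) _; rewrite ?leq_maxl.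
  by move=> /negPf ->; apply: runs_weaken (IH2 s) _; rewrite ?leq_maxr.
Qed.

(* [p] is the budget left: each turn of the loop must pay for itself out of it. *)
Lemma runs_while (R : realType) b P (Inv : nat -> state R -> Prop) p (s : state R) :
  (forall p s', Inv p s' -> frame P s s' -> beval s' b ->
    exists T p', (T + p' + (bcost b).+1 <= p)%N /\ runs P s' T (Inv p')) ->
  Inv p s ->
  runs (While b P) s (p + (bcost b).+1)
    (fun s' => ~~ beval s' b /\ exists p', Inv p' s').
Proof.
move=> step.
(* The frame stays relative to the fixed initial state [s] while the induction on the budget moves
   the current state [s']. *)
have: frame P s s by [].
move: {-1}s => s'; elim/ltn_ind: p s' => p IHp s' fs' Inv_s'.
have [bs'|bs'] := boolP (beval s' b); last first.
  exists (bcost b).+1, s'; split; [exact: ExecWhileF|exact: leq_addl|].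
  by split=> //; exists p.
have [T [p' [Tp' [t [s1 [e1 tT Inv1]]]]]] := step p s' Inv_s' fs' bs'.
have fs1 : frame P s s1 by apply: frame_trans fs' (exec_frame e1).
have p'p : (p' < p)%N by lia.
have [t2 [s2 [e2 t2T Q2]]] := IHp p' p'p s1 fs1 Inv1.
exists (bcost b + t + t2).+1, s2; split=> //; last by lia.
exact: ExecWhileT e1 e2.
Qed.

Lemma runs_count (R : realType) b P (Inv : nat -> state R -> Prop) n T (s : state R) :
  (forall j s', Inv j s' -> frame P s s' -> beval s' b = (j < n)%N) ->
  (forall j s', (j < n)%N -> Inv j s' -> frame P s s' -> runs P s' T (Inv j.+1)) ->
  Inv 0%N s ->
  runs (While b P) s (n * (T + (bcost b).+1) + (bcost b).+1) (Inv n).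
Proof.
move=> guard step Inv0.
(* The budget is the price of the turns still to come. *)
pose Inv' p s' := exists2 j, (j <= n)%N & Inv j s' /\ p = ((n - j) * (T + (bcost b).+1))%N.
apply: (@runs_weaken _ _ _ (n * (T + (bcost b).+1) + (bcost b).+1) _
  (fun s' => ~~ beval s' b /\ exists p', Inv' p' s')) => //.
  apply: runs_while; last by exists 0%N; rewrite ?subn0.
  move=> p s' [j jn [Inv_j ->]] fs' bs'.
  have jn' : (j < n)%N by rewrite -(guard j s').
  exists T, ((n - j.+1) * (T + (bcost b).+1))%N; split.
    by rewrite -(subnSK jn') mulSn; lia.
  apply: runs_weaken (step j s' jn' Inv_j fs') _ => // s1 Inv1 _.
  by exists j.+1.
move=> s' [nbs' [p' [j jn [Inv_j _]]]] fs'.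
have : ~~ (j < n)%N by rewrite -(guard j s').
by rewrite -leqNgt => nj; have -> : n = j by lia.
Qed.

(* Every scalar variable is cell 0 of an array of its own, so that [frame] can tell
   variables apart by their arrays. *)
Local Notation var v := (NGet v (NConst 0)).
Local Notation "v <~ e" := (NSet v (NConst 0) e) (at level 70).

Definition For (v : nat) (e : nexp) (P : cmd) : cmd :=
  Seq (v <~ NConst 0)
    (While (BNot (NLe e (var v))) (Seq P (v <~ NAdd (var v) (NConst 1)))).

Definition setv (R : realType) (s : state R) (v j : nat) : state R :=
  State (upd (nmem s) v 0%N j) (rmem s).

(** The invariant speaks of states whose counter is already updated, so proofs about bodies never
    meet the increment. The bound [e] is evaluated anew at every test and so has to keep its value
    under the frame. Initialisation costs 3, an increment 6, a test [ncost e + 5]. *)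
Lemma runs_for (R : realType) v e P (Inv : nat -> state R -> Prop) n T (s : state R) :
  (forall s', frame (For v e P) s s' -> neval s' e = n) ->
  v \notin nmods P ->
  (forall j s', (j < n)%N -> Inv j s' -> frame (For v e P) s s' -> nmem s' v 0%N = j ->
     runs P s' T (fun s1 => Inv j.+1 (setv s1 v j.+1))) ->
  Inv 0%N (setv s v 0%N) ->
  runs (For v e P) s (n * (T + ncost e + 11) + ncost e + 11) (Inv n).
Proof.
move=> en vP step Inv0.
have fv j s1 : frame (For v e P) s s1 -> frame (For v e P) s (setv s1 v j).
  move=> [fn fr]; split=> a i aP; last exact: fr.
  rewrite /setv /= /upd; case: eqP => [av|_]; last exact: fn.
  by move: aP; rewrite /= inE av eqxx.
pose Inv' j s' := [/\ Inv j s', frame (For v e P) s s' & nmem s' v 0%N = j].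
apply: (@runs_weaken _ _ _ (3 + (n * ((T + 6) + (ncost e + 5)) + (ncost e + 5))) _
  (Inv' n)); [by lia| |by move=> s' []].
apply: (@runs_seq _ _ _ _ _ _ (fun s' => s' = setv s v 0%N)).
  by apply: runs_lf.
move=> _ -> _.
have -> : (ncost e + 5)%N = (bcost (BNot (NLe e (var v)))).+1 by rewrite /=; lia.
apply: runs_count.
- move=> j s' [_ fs' vs'] _ /=; rewrite vs' en // -ltnNge //.
- move=> j s' jn [Inv_j fs' vs'] _.
  apply: (@runs_seq _ _ _ _ _ _ (fun s1 => Inv j.+1 (setv s1 v j.+1) /\ frame P s' s1)).
    exact: runs_frame (step j s' jn Inv_j fs' vs').
  move=> s1 [Inv1 f1] _; apply: runs_lf => //=.
  have vs1 : nmem s1 v 0%N = j by rewrite f1.1.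
  rewrite /Inv' vs1 addn1; split=> //.
    apply: fv; apply: frame_trans fs' _; apply: frame_sub f1 => a aP /=.
      by rewrite inE mem_cat aP orbT.
    by rewrite cats0.
  by rewrite /= /upd !eqxx.
- split=> //; first exact: fv.
  by rewrite /= /upd !eqxx.
Qed.

(** * Linear-time approximate medians *)

(** Ties are broken by index, so this is a strict total order on indices even when values repeat,
    and ranks are distinct. The form is the one that [sort_block] evaluates, with comparisons [<=]
    only. *)
Definition precedes (R : realType) (a : nat -> R) (i j : nat) : bool :=
  if (i < j)%N then a i <= a j else ~~ (a j <= a i).

Definition rank (R : realType) (a : nat -> R) (n j : nat) : nat :=
  \sum_(i < n) precedes a i j.

Definition tally (R : realType) (P : pred R) (a : nat -> R) (n : nat) : nat :=
  \sum_(i < n) P (a i).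

(** Treats the half-lines [x <= v] and [x < v] at once; rank estimates are needed for both. *)
Definition downclosed (R : realType) (P : pred R) : Prop :=
  forall x y, P x -> y <= x -> P y.

Lemma sum_ord_lt (n c : nat) : (\sum_(q < n) (q < c))%N = minn n c.
Proof.
elim: n => [|n IHn]; first by rewrite big_ord0 min0n.
by rewrite big_ord_recr /= IHn; lia.
Qed.

Lemma tally_le (R : realType) P (a : nat -> R) n : (tally P a n <= n)%N.
Proof.
rewrite /tally -[leqRHS]mul1n -[X in (_ <= _ * X)%N]card_ord mulnC -sum_nat_const.
by apply: leq_sum => i _; case: (P _).
Qed.

Lemma tally_cat (R : realType) P (a : nat -> R) n1 n2 :
  tally P a (n1 + n2) = (tally P a n1 + tally P (fun i => a (n1 + i)%N) n2)%N.
Proof. by rewrite /tally big_split_ord. Qed.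

Lemma eq_tally (R : realType) P (a a' : nat -> R) n :
  (forall i, (i < n)%N -> a i = a' i) -> tally P a n = tally P a' n.
Proof. by move=> aa'; apply: eq_bigr => i _; rewrite aa'. Qed.

Lemma precedes_lexi (R : realType) (a : nat -> R) i j :
  precedes a i j = (a i < a j) || (a i == a j) && (i < j)%N.
Proof.
rewrite /precedes; case: (ltnP i j) => _; rewrite ?andbT ?andbF ?orbF.
  by rewrite le_eqVlt orbC.
by rewrite -ltNge.
Qed.

Lemma precedes_trans (R : realType) (a : nat -> R) i j l :
  precedes a i j -> precedes a j l -> precedes a i l.
Proof.
rewrite !precedes_lexi => /orP[ij|/andP[/eqP ij ij']] /orP[jl|/andP[/eqP jl jl']].
- by rewrite (lt_trans ij jl).
- by rewrite -jl ij.
- by rewrite ij jl.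
- by rewrite ij jl eqxx (ltn_trans ij' jl') orbT.
Qed.

Lemma precedes_irr (R : realType) (a : nat -> R) i : ~~ precedes a i i.
Proof. by rewrite precedes_lexi ltxx ltnn andbF. Qed.

Lemma precedes_total (R : realType) (a : nat -> R) i j :
  i != j -> precedes a i j || precedes a j i.
Proof.
rewrite !precedes_lexi neq_ltn; case: (ltrgtP (a i) (a j)) => //= _.
Qed.

Lemma precedes_rank (R : realType) (a : nat -> R) n i j :
  (i < n)%N -> precedes a i j -> (rank a n i < rank a n j)%N.
Proof.
move=> i_n aij; rewrite /rank.
rewrite (bigD1 (Ordinal i_n)) //= [ltnRHS](bigD1 (Ordinal i_n)) //=.
rewrite aij (negPf (precedes_irr _ _)) add0n add1n ltnS.
apply: leq_sum => l _; case li: (precedes a l i) => //.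
by rewrite (precedes_trans li aij).
Qed.

Lemma rank_inj (R : realType) (a : nat -> R) n i j :
  (i < n)%N -> (j < n)%N -> rank a n i = rank a n j -> i = j.
Proof.
move=> i_n j_n rij; apply/eqP/negPn/negP => /(precedes_total a) /orP[] H.
  by have := precedes_rank i_n H; rewrite rij ltnn.
by have := precedes_rank j_n H; rewrite rij ltnn.
Qed.

Lemma rank_lt (R : realType) (a : nat -> R) n j : (j < n)%N -> (rank a n j < n)%N.
Proof.
move=> j_n; rewrite /rank (bigD1 (Ordinal j_n)) //= (negPf (precedes_irr _ _)) add0n.
apply: (@leq_ltn_trans (\sum_(i < n | i != Ordinal j_n) 1)).
  by apply: leq_sum => i _; case: precedes.
by rewrite sum1_card cardC1 card_ord; lia.
Qed.

(** On the indices below [n] the rank is an injective self-map of a finite set, hence a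
    permutation. *)
Lemma rank_surj (R : realType) (a : nat -> R) n q :
  (q < n)%N -> exists2 j, (j < n)%N & rank a n j = q.
Proof.
move=> q_n; pose f (j : 'I_n) := Ordinal (rank_lt a (ltn_ord j)).
have f_inj : injective f.
  by move=> i j /(congr1 val) /= /rank_inj H; apply: val_inj; apply: H.
have /injF_bij[g _ fK] := f_inj.
exists (g (Ordinal q_n)) => //.
by have /(congr1 val) := fK (Ordinal q_n).
Qed.

(** In sorted order an initial segment of the reals occupies an initial segment of positions. If
    [P (a j)] holds, all predecessors of [j] satisfy [P] and [j] itself does not count as one;
    otherwise everything satisfying [P] precedes [j]. *)
Lemma rank_tally (R : realType) (P : pred R) (a : nat -> R) n j :
  downclosed P -> (j < n)%N -> P (a j) = (rank a n j < tally P a n)%N.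
Proof.
move=> Pdown j_n; rewrite /rank /tally; case Pj: (P (a j)).
  rewrite (bigD1 (Ordinal j_n)) //= [ltnRHS](bigD1 (Ordinal j_n)) //= Pj.
  rewrite (negPf (precedes_irr _ _)) add0n add1n ltnS; apply/esym/leq_sum => i _.
  case ij: (precedes a i j) => //.
  suff -> : P (a i) by [].
  apply: Pdown Pj _; move: ij; rewrite precedes_lexi => /orP[/ltW //|].
  by case/andP=> /eqP ->.
apply/esym/negbTE; rewrite -leqNgt; apply: leq_sum => i _.
case Pi: (P (a i)) => //; rewrite precedes_lexi.
have [//|ji] := ltP (a i) (a j).
by rewrite (Pdown _ _ Pi ji) in Pj.
Qed.

Lemma sorted_tally (R : realType) (P : pred R) (a b : nat -> R) n q :
  downclosed P -> (forall j, (j < n)%N -> b (rank a n j) = a j) ->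
  (q < n)%N -> P (b q) = (q < tally P a n)%N.
Proof.
move=> Pdown ab /(rank_surj a)[j j_n <-]; rewrite ab //; exact: rank_tally.
Qed.

(** Position [4 * q + 3] lies below [t] exactly when [q < t %/ 4]. Keeping the last of each four
    thus never overcounts and loses at most 3. *)
Lemma every_fourth_tally (R : realType) (P : pred R) (a b : nat -> R) n :
  downclosed P -> (forall j, (j < n)%N -> b (rank a n j) = a j) ->
  tally P (fun q => b (4 * q + 3)%N) (n %/ 4) = (tally P a n %/ 4)%N.
Proof.
move=> Pdown ab; rewrite {1}/tally.
rewrite (eq_bigr (fun q : 'I_(n %/ 4) => (q < tally P a n %/ 4)%N : nat)); last first.
  move=> q _; have q4 := ltn_ord q; rewrite (sorted_tally Pdown ab); last by lia.
  by congr nat_of_bool; lia.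
by rewrite sum_ord_lt; have := tally_le P a n; lia.
Qed.

(* The sample [b] of size [n'] estimates, up to [E], every initial count of [a]
   when each of its entries stands for [w] entries of [a]. *)
Definition sample (R : realType) (w E : nat) (a : nat -> R) (n : nat)
    (b : nat -> R) (n' : nat) : Prop :=
  forall P, downclosed P -> (w * tally P b n' <= tally P a n <= w * tally P b n' + E)%N.

(** An error of the second sample is counted in entries of [b], each of which stands for [w1]
    entries of [a]. *)
Lemma sample_trans (R : realType) w1 E1 w2 E2 (a b c : nat -> R) n1 n2 n3 :
  sample w1 E1 a n1 b n2 -> sample w2 E2 b n2 c n3 ->
  sample (w1 * w2) (E1 + w1 * E2) a n1 c n3.
Proof.
move=> ab bc P Pd; have /andP[h1 h2] := ab P Pd; have /andP[h3 h4] := bc P Pd.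
apply/andP; split; first by apply: leq_trans h1; rewrite -mulnA leq_mul2l h3 orbT.
by have := leq_mul (leqnn w1) h4; rewrite mulnDr mulnA; lia.
Qed.

(** The share 5/16 matches [few_noisy_rows]: the noisy rows are too few to fill either side. *)
Definition near_median (R : realType) (a : nat -> R) (n : nat) (v : R) : Prop :=
  (5 * n <= 16 * tally (fun x => (x <= v)%R) a n)%N /\
  (5 * n <= 16 * tally (fun x => (v <= x)%R) a n)%N.

Lemma tally_ltge (R : realType) (a : nat -> R) n v :
  (tally (fun x => (x < v)%R) a n + tally (fun x => (v <= x)%R) a n)%N = n.
Proof.
rewrite /tally -big_split /= -[RHS](card_ord n) -sum1_card; apply: eq_bigr => i _.
by case: ltP.
Qed.

Lemma tally_true (R : realType) (a : nat -> R) n : tally predT a n = n.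
Proof. by rewrite /tally sum_nat_const card_ord muln1. Qed.

(** The middle of the sorted sample has about half of the sample on either side. Carried over to the
    data this loses at most [E], that is 3/16 of them, and 1/2 - 3/16 = 5/16. *)
Lemma sample_median (R : realType) w E (a b c : nat -> R) n n' :
  sample w E a n b n' -> (forall j, (j < n')%N -> c (rank b n' j) = b j) ->
  (16 * E <= 3 * n)%N -> (0 < n)%N -> near_median a n (c n'./2).
Proof.
move=> ab bc En n_gt0; set v := c n'./2.
have Tdown : downclosed (@predT R) by [].
have ledown : downclosed (fun x : R => x <= v) by move=> x y xv yx; apply: le_trans xv.
have ltdown : downclosed (fun x : R => x < v) by move=> x y xv yx; apply: le_lt_trans xv.
have := ab _ Tdown; rewrite !tally_true => nn'.
have n'_gt0 : (0 < n')%N by case: (n') nn' => //; rewrite muln0 => /andP[_]; lia.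
have h_n' : (n'./2 < n')%N by lia.
have := sorted_tally ledown bc h_n'; rewrite -/v lexx => /esym h_le.
have := sorted_tally ltdown bc h_n'; rewrite -/v ltxx => /esym/negbT; rewrite -leqNgt => h_lt.
have /andP[le1 _] := ab _ ledown; have /andP[_ lt2] := ab _ ltdown.
have := tally_ltge a n v => Hsum.
move: h_le h_lt le1 lt2 Hsum; rewrite /near_median.
set tle := tally _ b n'; set tle' := tally _ a n; set tlt := tally _ b n'.
set tlt' := tally _ a n; set tge := tally _ a n => h_le h_lt le1 lt2 Hsum.
have H1 : (w * n' <= 2 * (w * tle))%N by rewrite mulnCA leq_mul2l; apply/orP; right; lia.
have H2 : (2 * (w * tlt) <= w * n')%N by rewrite mulnCA leq_mul2l; apply/orP; right; lia.
by split; lia.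
Qed.

(** * Working memory ([i]: arrays of naturals, [r]: arrays of reals) and the median program *)

Local Notation iROW := 2%N (only parsing).
Local Notation iPOW := 3%N (only parsing).
Local Notation iPOS := 4%N (only parsing).
Local Notation iCODE := 5%N (only parsing).
Local Notation iCOUNT := 6%N (only parsing).
Local Notation iCAND := 7%N (only parsing).
Local Notation iNCAND := 8%N (only parsing).
Local Notation iC := 9%N (only parsing).
Local Notation iLEN := 10%N (only parsing).
Local Notation iBLOCK := 11%N (only parsing).
Local Notation iLO := 12%N (only parsing).
Local Notation iG := 13%N (only parsing).
Local Notation iOUT := 14%N (only parsing).
Local Notation iJ := 15%N (only parsing).
Local Notation iL := 16%N (only parsing).
Local Notation iRANK := 17%N (only parsing).
Local Notation iBEST := 18%N (only parsing).
Local Notation iROUND := 19%N (only parsing).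
Local Notation iQ := 20%N (only parsing).
Local Notation rDATA := 5%N (only parsing).
Local Notation rSORT := 6%N (only parsing).
Local Notation rZRE := 7%N (only parsing).
Local Notation rZIM := 8%N (only parsing).
Local Notation rMAG := 9%N (only parsing).
Local Notation rBEST := 10%N (only parsing).
Local Notation rMED := 11%N (only parsing).
Local Notation "P ;; Q" := (Seq P Q) (at level 75, right associativity).
Local Notation incr v := (v <~ NAdd (var v) (NConst 1)).
Local Notation datum v := (RGet rDATA (NAdd (var iLO) (var v))).

(** Sorting by ranks: comparisons count the final position of an entry, which is then written there.
    The cost is quadratic in the block length; over a pass it amounts to block length times data
    length. *)
Definition sort_block : cmd :=
  For iJ (var iG)
    (iRANK <~ NConst 0 ;;
     For iL (var iG)
       (If (NLe (NAdd (var iL) (NConst 1)) (var iJ))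
          (If (RLe (datum iL) (datum iJ)) (incr iRANK) Skip)
          (If (RLe (datum iJ) (datum iL)) Skip (incr iRANK))) ;;
     RSet rSORT (var iRANK) (datum iJ)).

Lemma sort_block_runs (R : realType) (s : state R) lo g :
  nmem s iLO 0%N = lo -> nmem s iG 0%N = g ->
  let a i := rmem s rDATA (lo + i)%N in
  runs sort_block s (100 * (g * g) + 20)
    (fun s' => forall j, (j < g)%N -> rmem s' rSORT (rank a g j) = a j).
Proof.
move=> sLO sG a.
pose Inv j (s' : state R) :=
  forall i, (i < j)%N -> rmem s' rSORT (rank a g i) = a i.
apply: (@runs_weaken _ _ _ (g * ((43 * g + 36) + 2 + 11) + 2 + 11) _ (Inv g)) => //.
  by case: (g) => [|g'] //; nia.
apply: runs_for => //.
- by move=> s' fs' /=; rewrite fs'.1.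
move=> j s' j_g Inv_j fs' s'j.
apply: (@runs_weaken _ _ _ (3 + ((g * (28 + 2 + 11) + 2 + 11) + 10)) _
  (fun s1 => Inv j.+1 (setv s1 iJ j.+1))) => //; first by lia.
apply: (@runs_seq _ _ _ _ _ _ (fun s1 => nmem s1 iRANK 0%N = 0%N)).
  by apply: runs_lf.
move=> s1 s1R fs1.
apply: (@runs_seq _ _ _ _ _ _ (fun s1 => nmem s1 iRANK 0%N = rank a g j)).
  apply: (runs_for (Inv := fun l s2 =>
    nmem s2 iRANK 0%N = (\sum_(i < l) precedes a i j)%N)) => //.
  - by move=> s2 fs2 /=; rewrite fs2.1 // fs1.1 // fs'.1.
  - move=> l s2 l_g s2R fs2 s2L; apply: runs_lf => //=.
    have E3 i : rmem s2 rDATA i = rmem s rDATA i by rewrite fs2.2 // fs1.2 // fs'.2.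
    have s2J : nmem s2 iJ 0%N = j by rewrite fs2.1 // fs1.1.
    have s2LO : nmem s2 iLO 0%N = lo by rewrite fs2.1 // fs1.1 // fs'.1.
    rewrite big_ord_recr /= -s2R s2J s2L s2LO !E3 -/(a l) -/(a j) addn1 /precedes.
    by case: ltnP => _; case: ifP => _ /=; rewrite /upd /= ?addn0 ?addn1 ?s2R.
  - by rewrite big_ord0 /= /upd /= s1R.
move=> s2 s2R fs2; apply: runs_lf => //= i.
have s2J : nmem s2 iJ 0%N = j by rewrite fs2.1 // fs1.1.
have s2LO : nmem s2 iLO 0%N = lo by rewrite fs2.1 // fs1.1 // fs'.1.
have E3 l : rmem s2 rDATA l = rmem s rDATA l by rewrite fs2.2 // fs1.2 // fs'.2.
rewrite ltnS /setv /upd /= s2R s2J s2LO E3 => i_j.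
have [->|ij] := eqVneq i j; first by rewrite eqxx.
(* Distinct indices have distinct ranks, so nothing written earlier is overwritten. *)
rewrite ifN; last by apply: contra ij => /eqP /rank_inj -> //; lia.
by rewrite fs2.2 // fs1.2 // Inv_j //; lia.
Qed.

Definition gather_block : cmd :=
  iQ <~ NConst 0 ;;
  While (NLe (NAdd (NMul (NConst 4) (var iQ)) (NConst 4)) (var iG))
    (RSet rDATA (var iOUT)
       (RGet rSORT (NAdd (NMul (NConst 4) (var iQ)) (NConst 3))) ;;
     incr iOUT ;; incr iQ).

Lemma gather_block_runs (R : realType) (s : state R) out g :
  nmem s iOUT 0%N = out -> nmem s iG 0%N = g ->
  runs gather_block s (50 * g + 30)
    (fun s' => [/\ nmem s' iOUT 0%N = (out + g %/ 4)%N,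
       (forall q, (q < g %/ 4)%N ->
          rmem s' rDATA (out + q)%N = rmem s rSORT (4 * q + 3)%N) &
       (forall i, (i < out)%N || (out + g %/ 4 <= i)%N ->
          rmem s' rDATA i = rmem s rDATA i)]).
Proof.
move=> sOUT sG.
pose Inv j (s' : state R) := [/\ nmem s' iQ 0%N = j, nmem s' iOUT 0%N = (out + j)%N,
  (forall q, (q < j)%N -> rmem s' rDATA (out + q)%N = rmem s rSORT (4 * q + 3)%N) &
  (forall i, (i < out)%N || (out + j <= i)%N -> rmem s' rDATA i = rmem s rDATA i)].
apply: (@runs_weaken _ _ _ (3 + (g %/ 4 * (25 + 10) + 10))%N _ (Inv (g %/ 4)%N)).
- by lia.
apply: (@runs_seq _ _ _ _ _ _ (fun s' => Inv 0%N s' /\ frame (iQ <~ NConst 0) s s')).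
  apply/runs_frame/runs_lf => //=; split => //=.
  by rewrite /upd /= sOUT addn0.
move=> s1 [Inv1 fs1] _; apply: (runs_count (n := g %/ 4)) => //.
- move=> j s2 [s2Q s2OUT s2D s2A] fs2 /=; rewrite s2Q fs2.1 // fs1.1 // sG; lia.
- move=> j s2 j_g [s2Q s2OUT s2D s2A] fs2; apply: runs_lf => //=.
  rewrite /Inv /= /upd /= s2Q s2OUT !addn1 addnS; split=> //.
    move=> q; rewrite ltnS leq_eqVlt => /orP[/eqP->|q_j].
      by rewrite eqxx fs2.2 // fs1.2.
    by rewrite eqn_add2l ifN ?s2D //; lia.
  by move=> i i_out; rewrite ifN ?s2A //; lia.
by move=> s' [].
Qed.

(** The sample overwrites the front of the data in place: at most one entry is written for four
    read, so nothing unread is lost. The last block may be short. *)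
Definition thin_data : cmd :=
  iLO <~ NConst 0 ;; iOUT <~ NConst 0 ;;
  While (NLe (NAdd (var iLO) (NConst 1)) (var iLEN))
    (If (NLe (var iBLOCK) (NSub (var iLEN) (var iLO)))
       (iG <~ var iBLOCK) (iG <~ NSub (var iLEN) (var iLO)) ;;
     sort_block ;; gather_block ;;
     iLO <~ NAdd (var iLO) (var iG)) ;;
  iLEN <~ var iOUT ;; iBLOCK <~ NMul (NConst 2) (var iBLOCK).

(** Initial counts are additive over blocks, and the new block reports [4 * (t %/ 4)] for its count
    [t]. *)
Lemma sample_block (R : realType) E (a d d' c : nat -> R) lo out g :
  sample 4 E a lo d out ->
  (forall i, (i < out)%N -> d' i = d i) ->
  (forall j, (j < g)%N -> c (rank (fun i => a (lo + i)%N) g j) = a (lo + j)%N) ->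
  (forall q, (q < g %/ 4)%N -> d' (out + q)%N = c (4 * q + 3)%N) ->
  sample 4 (E + 3) a (lo + g) d' (out + g %/ 4).
Proof.
move=> ad dd' ac cd' P Pdown; rewrite !tally_cat (eq_tally P dd').
rewrite (eq_tally P cd') (every_fourth_tally Pdown ac).
by have := ad P Pdown; lia.
Qed.

Lemma thin_data_runs (R : realType) (s : state R) n b :
  nmem s iLEN 0%N = n -> nmem s iBLOCK 0%N = b -> (0 < b <= n)%N ->
  runs thin_data s (300 * (b * n) + 50)
    (fun s' => exists E, [/\ nmem s' iBLOCK 0%N = (2 * b)%N,
       (4 * nmem s' iLEN 0%N <= n)%N, (b * E <= 6 * n)%N &
       sample 4 E (rmem s rDATA) n (rmem s' rDATA) (nmem s' iLEN 0%N)]).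
Proof.
move=> sLEN sBLOCK /andP[b_gt0 b_n]; set a := rmem s rDATA.
(* A full block adds 3 to [E] and [b] to [lo], so [b * E <= 3 * lo] while data remain. A short last
   block may add a further [3 * b], and [b <= n] then gives [6 * n]. Each unread entry carries a
   budget of [300 * b]. *)
pose Inv p (s' : state R) := exists lo E, let out := nmem s' iOUT 0%N in
  [/\ p = (300 * (b * (n - lo)))%N, (lo <= n)%N, nmem s' iLO 0%N = lo, (4 * out <= lo)%N &
   [/\ forall i, (lo <= i)%N -> rmem s' rDATA i = a i,
      sample 4 E a lo (rmem s' rDATA) out,
      (lo < n)%N -> (b * E <= 3 * lo)%N & (b * E <= 3 * lo + 3 * b)%N]].
apply: (@runs_weaken _ _ _ (3 + (3 + ((300 * (b * n) + 8) + (4 + 6))))%N _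
  (fun s' => exists E, [/\ nmem s' iBLOCK 0%N = (2 * b)%N,
       (4 * nmem s' iLEN 0%N <= n)%N, (b * E <= 6 * n)%N &
       sample 4 E a n (rmem s' rDATA) (nmem s' iLEN 0%N)])) => //; first by lia.
apply: (@runs_seq _ _ _ _ _ _ (fun s' => nmem s' iLO 0%N = 0%N)); first exact: runs_lf.
move=> s1 s1LO fs1.
apply: (@runs_seq _ _ _ _ _ _ (fun s' => nmem s' iOUT 0%N = 0%N)); first exact: runs_lf.
move=> s2 s2OUT fs2.
apply: runs_seq.
  apply: (runs_while (Inv := Inv) (p := (300 * (b * n))%N)); last first.
    exists 0%N, 0%N; rewrite s2OUT fs2.1 // s1LO subn0; split=> //; split=> //.
    - by move=> i _; rewrite fs2.2 // fs1.2.
    - by move=> P _; rewrite /tally !big_ord0.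
    - by rewrite !muln0.
    - by rewrite muln0.
  move=> p s3 [lo [E [-> lo_n s3LO out_lo [s3D samp E1 E2]]]] fs3.
  rewrite /= s3LO fs3.1 // fs2.1 // fs1.1 // sLEN addn1 => lo_lt_n.
  have s3LEN : nmem s3 iLEN 0%N = n by rewrite fs3.1 // fs2.1 // fs1.1.
  have s3BLOCK : nmem s3 iBLOCK 0%N = b by rewrite fs3.1 // fs2.1 // fs1.1.
  pose g := minn b (n - lo).
  exists (16 + ((100 * (g * g) + 20) + ((50 * g + 30) + 10)))%N, (300 * (b * (n - (lo + g))))%N.
  split.
    have g_gt0 : (0 < g)%N by rewrite /g; lia.
    have g_b : (g <= b)%N by rewrite /g; lia.
    have -> : (n - lo = n - (lo + g) + g)%N by rewrite /g; lia.
    rewrite !mulnDr; have h1 := leq_mul g_b (leqnn g).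
    have h2 := leq_mul b_gt0 (leqnn g); lia.
  apply: (@runs_seq _ _ _ _ _ _ (fun s' => nmem s' iG 0%N = g)).
    apply: runs_lf => //=; rewrite s3LEN s3BLOCK s3LO.
    by case: ifP => /=; rewrite /upd /= /g; lia.
  move=> s4 s4G fs4.
  apply: runs_seq.
    apply: (sort_block_runs (lo := lo)) s4G; by rewrite fs4.1.
  move=> s5 s5S fs5.
  apply: runs_seq.
    apply: (gather_block_runs (out := nmem s3 iOUT 0%N) (g := g)).
      by rewrite fs5.1 // fs4.1.
    by rewrite fs5.1.
  move=> s6 [s6OUT s6D s6A] fs6; apply: runs_lf => //=.
  have s6LO : nmem s6 iLO 0%N = lo by rewrite fs6.1 // fs5.1 // fs4.1.
  have s6G : nmem s6 iG 0%N = g by rewrite fs6.1 // fs5.1.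
  exists (lo + g)%N, (E + 3)%N; rewrite /= /upd /= s6LO s6G s6OUT; split=> //.
  - by rewrite /g; lia.
  - by lia.
  split.
  - move=> i i_lo; rewrite s6A; last by lia.
    by rewrite fs5.2 // fs4.2 // s3D //; lia.
  - apply: sample_block samp _ _ s6D.
      by move=> i i_out; rewrite s6A ?i_out // fs5.2 // fs4.2.
    move=> j j_g; have := s5S j j_g; rewrite fs4.2 // s3D; last by lia.
    move=> <-; congr (rmem s5 _ _); apply: eq_bigr => i _; congr nat_of_bool.
    by rewrite /precedes !fs4.2 // !s3D //; lia.
  - move=> lo_g; have -> : g = b by rewrite /g in lo_g *; lia.
    by rewrite !mulnDr; have := E1 lo_lt_n; lia.
  - rewrite !mulnDr; have := E1 lo_lt_n; lia.
move=> s3 [s3b [_ [lo [E [_ lo_n s3LO out_lo [s3D samp E1 E2]]]]]] fs3.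
have s3LEN : nmem s3 iLEN 0%N = n by rewrite fs3.1 // fs2.1 // fs1.1.
have s3BLOCK : nmem s3 iBLOCK 0%N = b by rewrite fs3.1 // fs2.1 // fs1.1.
move: s3b; rewrite /= s3LO s3LEN addn1 -leqNgt => lo_n'; have lo_eq : lo = n by lia.
rewrite lo_eq in out_lo samp E2; apply: (runs_lf (P := Seq _ _)) => //=; exists E.
by rewrite /upd /= s3BLOCK; split=> //; lia.
Qed.

(** Thinning stops when the remaining data are shorter than a block; they are then sorted outright.
    Natural expressions have no division, so the middle position is found by counting. *)
Definition approx_median (src : nat) : cmd :=
  For iJ (NGet 0 (NConst 2))
    (RSet rDATA (var iJ)
       (RGet src (NGet 1 (NAdd (NMul (NGet iCAND (var iC)) (NGet 0 (NConst 2)))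
                               (var iJ))))) ;;
  iLEN <~ NGet 0 (NConst 2) ;; iBLOCK <~ NConst 64 ;;
  While (NLe (var iBLOCK) (var iLEN)) thin_data ;;
  iLO <~ NConst 0 ;; iG <~ var iLEN ;; sort_block ;;
  iQ <~ NConst 0 ;;
  While (NLe (NAdd (NMul (NConst 2) (var iQ)) (NConst 2)) (var iLEN)) (incr iQ) ;;
  RSet rMED (NConst 0) (RGet rSORT (var iQ)).

Lemma approx_median_runs (R : realType) (s : state R) src n c :
  src \notin [:: rDATA; rSORT; rMED] ->
  nmem s 0%N 2%N = n -> nmem s iC 0%N = c -> (0 < n)%N ->
  let a j := rmem s src (nmem s 1%N (nmem s iCAND c * n + j)%N) in
  runs (approx_median src) s (1000 * 100 * n + 1000)
    (fun s' => near_median a n (rmem s' rMED 0%N)).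
Proof.
move=> src_ok sK sC n_gt0 a.
pose med1 := fun s' : state R => forall i, (i < n)%N -> rmem s' rDATA i = a i.
apply: (@runs_weaken _ _ _ ((n * (20 + 2 + 11) + 2 + 11) + (5 + (3 +
  ((800 * (n * 64) + 6) + (3 + (4 + ((100 * (64 * n) + 20) + (3 +
  ((64 * n * (10 + 10) + 20) + 5)))))))))%N _
  (fun s' => near_median a n (rmem s' rMED 0%N))) => //; first by lia.
apply: (@runs_seq _ _ _ _ _ _ med1).
  apply: (@runs_weaken _ _ _ (n * (20 + 2 + 11) + 2 + 11)%N _ (fun s' =>
     forall i, (i < n)%N -> rmem s' rDATA i = a i)) => //.
  apply: (runs_for (Inv := fun j s' => forall i, (i < j)%N -> rmem s' rDATA i = a i)) => //.
    by move=> s' fs' /=; rewrite fs'.1.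
  move=> j s' j_n Ij fs' s'J; apply: runs_lf => //= i i_j.
  rewrite /upd /= s'J; case: eqP => [->|ij]; last by apply: Ij; lia.
  rewrite fs'.2; last by rewrite /= inE; apply: contra src_ok => /eqP ->.
  by rewrite !fs'.1 // sK sC.
move=> s1 s1D fs1; apply: (@runs_seq _ _ _ _ _ _ (fun s' => nmem s' iLEN 0%N = n)).
  by apply: runs_lf => //=; rewrite /upd /= fs1.1.
move=> s2 s2LEN fs2; apply: (@runs_seq _ _ _ _ _ _ (fun s' => nmem s' iBLOCK 0%N = 64)).
  exact: runs_lf.
move=> s3 s3B fs3.
(* A pass loses at most [3] per block, that is [6 w n' / b] ranks of the data, and
   [w n' / b] halves from pass to pass; starting with [b = 64] the total loss is
   below [12 n / 64]. *)
pose Inv p (s' : state R) := exists w E, let n' := nmem s' iLEN 0%N in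
  let b := nmem s' iBLOCK 0%N in
  [/\ (800 * (n' * b) <= p)%N, (0 < b)%N, (n' * b <= n * 64)%N,
    (16 * (b * E + 12 * (w * n')) <= 3 * (n * b))%N & sample w E a n (rmem s' rDATA) n'].
apply: runs_seq.
  apply: (runs_while (Inv := Inv) (p := (800 * (n * 64))%N)); last first.
    exists 1%N, 0%N; rewrite /= s3B fs3.1 // s2LEN; split=> //; first by lia.
    move=> P _; have -> : tally P (rmem s3 rDATA) n = tally P a n; last by lia.
    by apply: eq_tally => i i_n; rewrite fs3.2 // fs2.2 // s1D.
  move=> p s4 [w [E [pE b_gt0 nb nE samp]]] fs4 /= b_n.
  set n' := nmem s4 iLEN 0%N in pE nb nE samp b_n *.
  set b := nmem s4 iBLOCK 0%N in pE b_gt0 nb nE b_n *.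
  (* A pass divides [n'] by at least 4 and doubles [b], so the product at least halves. Half of the
     budget is kept for later passes. *)
  exists (300 * (b * n') + 50)%N, (400 * (n' * b))%N; split.
    have : (0 < b * n')%N by rewrite muln_gt0 b_gt0 (leq_trans b_gt0 b_n).
    by move: pE; rewrite (mulnC b n') => ? ?; lia.
  apply: runs_weaken (thin_data_runs (n := n') (b := b) _ _ _) _ => //; first by rewrite b_gt0.
  move=> s5 [E' [s5B s5n bE' samp']] _.
  exists (w * 4)%N, (E + w * E')%N; rewrite /= s5B; set n'' := nmem s5 iLEN 0%N in s5n samp' *.
  have nb' : (b * (4 * n'') <= b * n')%N by rewrite leq_mul2l s5n orbT.
  have nb'' : (n'' * (2 * b) * 2 <= n' * b)%N by lia.
  split; [by lia|by lia|by lia| |exact: sample_trans samp samp'].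
  have wn : (w * (4 * n'') <= w * n')%N by rewrite leq_mul2l s5n orbT.
  have wE : (w * (b * E') <= w * (6 * n'))%N by rewrite leq_mul2l bE' orbT.
  rewrite !mulnDr; lia.
move=> s4 [s4b [_ [w [E [_ b_gt0 nb nE samp]]]]] fs4.
set n' := nmem s4 iLEN 0%N in nb nE samp; set b := nmem s4 iBLOCK 0%N in b_gt0 nb nE.
move: s4b; rewrite /= -ltnNge -/n' -/b => n'_b.
apply: (@runs_seq _ _ _ _ _ _ (fun s' => nmem s' iLO 0%N = 0%N)); first exact: runs_lf.
move=> s5 s5LO fs5; apply: (@runs_seq _ _ _ _ _ _ (fun s' => nmem s' iG 0%N = n')).
  by apply: runs_lf => //=; rewrite /upd /= fs5.1.
move=> s6 s6G fs6.
have n'_64 : (n' <= n * 64)%N by apply: leq_trans nb; rewrite leq_pmulr.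
(* Since [n' < b] at the end of the loop, the final quadratic sort costs [n' * n' <= n' * b], still
   linear in [n]. *)
have n'n' : (n' * n' <= n * 64)%N by apply: leq_trans nb; rewrite leq_mul2l ltnW ?orbT.
apply: runs_seq.
  apply: (runs_weaken _ (sort_block_runs (lo := 0%N) _ s6G)).
  - by lia.
  - by rewrite fs6.1.
  - by move=> s' Q _; exact: Q.
move=> s7 s7S fs7; apply: (@runs_seq _ _ _ _ _ _ (fun s' => nmem s' iQ 0%N = 0%N)).
  exact: runs_lf.
move=> s8 s8Q fs8.
have s8LEN : nmem s8 iLEN 0%N = n' by rewrite fs8.1 // fs7.1 // fs6.1 // fs5.1.
apply: (@runs_seq _ _ _ _ _ _ (fun s' => nmem s' iQ 0%N = n'./2)).
  apply: (@runs_weaken _ _ _ (n'./2 * (6 + 10) + 10)%N _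
    (fun s' => nmem s' iQ 0%N = n'./2)) => //.
    by lia.
  apply: (runs_count (Inv := fun j s' => nmem s' iQ 0%N = j)) => //.
  - by move=> j s' s'Q fs' /=; rewrite s'Q fs'.1 // s8LEN; lia.
  - by move=> j s' _ s'Q _; apply: runs_lf => //=; rewrite /upd /= s'Q addn1.
move=> s9 s9Q fs9; apply: runs_lf => //=; rewrite /upd /= s9Q fs9.2 // fs8.2 //.
have En : (16 * E <= 3 * n)%N.
  by rewrite -(leq_pmul2l b_gt0); move: nE; rewrite !mulnDr; lia.
apply: sample_median samp _ En n_gt0 => j j_n'.
have dataE : (fun i => rmem s6 rDATA (0 + i)%N) = rmem s4 rDATA.
  by apply/funext => i; rewrite add0n fs6.2 // fs5.2.
by have := s7S j j_n'; rewrite dataE => ->; rewrite -dataE.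
Qed.

(** * The recovery program *)

Local Notation nROWS := (NGet 0 (NConst 0)) (only parsing).
Local Notation nCOLS := (NGet 0 (NConst 1)) (only parsing).
Local Notation nWEIGHT := (NGet 0 (NConst 2)) (only parsing).
Local Notation nSPARSITY := (NGet 0 (NConst 4)) (only parsing).

Definition sqr_mag (re im : rexp) : rexp := RAdd (RMul re re) (RMul im im).

(** A bit is read as 1 when the measurement through its bit test exceeds in modulus the plain
    measurement minus it; squared moduli avoid roots. Successive bit tests of one row lie [m] cells
    apart. *)
Definition decode_row : cmd :=
  iCODE <~ NConst 0 ;; iPOW <~ NConst 1 ;; iPOS <~ NAdd (var iROW) nROWS ;;
  While (NLe (NAdd (var iPOW) (NConst 1)) nCOLS)
    (If (RLe (sqr_mag (RGet 0 (var iPOS)) (RGet 1 (var iPOS)))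
             (sqr_mag (RSub (RGet 0 (var iROW)) (RGet 0 (var iPOS)))
                      (RSub (RGet 1 (var iROW)) (RGet 1 (var iPOS)))))
       Skip (iCODE <~ NAdd (var iCODE) (var iPOW)) ;;
     iPOW <~ NMul (NConst 2) (var iPOW) ;;
     iPOS <~ NAdd (var iPOS) nROWS).

Definition bit_heard (R : realType) (m : nat) (yr yi : nat -> R) (i b : nat) : bool :=
  let p := (i + m * b.+1)%N in
  (yr i - yr p) * (yr i - yr p) + (yi i - yi p) * (yi i - yi p)
    < yr p * yr p + yi p * yi p.

Definition code (R : realType) (m N : nat) (yr yi : nat -> R) (i : nat) : nat :=
  \sum_(b < up_log 2 N) bit_heard m yr yi i b * 2 ^ b.

Lemma lt_up_log (j N : nat) : (2 ^ j < N)%N = (j < up_log 2 N)%N.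
Proof.
rewrite !ltnNge; congr negb; apply/idP/idP => [|H]; first exact: up_log_min.
by apply: leq_trans (up_logP N (isT : (1 < 2)%N)) _; rewrite leq_pexp2l.
Qed.

Lemma decode_row_runs (R : realType) (s : state R) m N i :
  nmem s 0%N 0%N = m -> nmem s 0%N 1%N = N -> nmem s iROW 0%N = i ->
  runs decode_row s (100 * up_log 2 N + 50)
    (fun s' => nmem s' iCODE 0%N = code m N (rmem s 0%N) (rmem s 1%N) i).
Proof.
move=> sm sN sI; set L := up_log 2 N.
pose Inv j (s' : state R) := [/\ nmem s' iPOW 0%N = (2 ^ j)%N,
  nmem s' iPOS 0%N = (i + m * j.+1)%N &
  nmem s' iCODE 0%N =
    (\sum_(b < j) bit_heard m (rmem s 0%N) (rmem s 1%N) i b * 2 ^ b)%N].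
apply: (@runs_weaken _ _ _ (3 + (3 + (10 + (L * (80 + 8) + 8))))%N _ (Inv L)) => //.
- by lia.
- apply: (@runs_seq _ _ _ _ _ _ (fun s' => nmem s' iCODE 0%N = 0%N)); first exact: runs_lf.
  move=> s1 s1C fs1.
  apply: (@runs_seq _ _ _ _ _ _ (fun s' => nmem s' iPOW 0%N = 1%N)); first exact: runs_lf.
  move=> s2 s2P fs2.
  apply: (@runs_seq _ _ _ _ _ _ (fun s' => nmem s' iPOS 0%N = (i + m)%N)).
    by apply: runs_lf => //=; rewrite /upd /= !fs2.1 // !fs1.1 // sI sm.
  move=> s3 s3P fs3; apply: runs_count.
  + move=> j s4 [s4P _ _] fs4 /=.
    by rewrite s4P fs4.1 // fs3.1 // fs2.1 // fs1.1 // sN addn1 lt_up_log.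
  + move=> j s4 jL [s4P s4S s4C] fs4; apply: runs_lf => //=.
    have s4I : nmem s4 iROW 0%N = i by rewrite fs4.1 // fs3.1 // fs2.1 // fs1.1.
    have s4m : nmem s4 0%N 0%N = m by rewrite fs4.1 // fs3.1 // fs2.1 // fs1.1.
    have s4r l : rmem s4 0%N l = rmem s 0%N l by rewrite fs4.2 // fs3.2 // fs2.2 // fs1.2.
    have s4i l : rmem s4 1%N l = rmem s 1%N l by rewrite fs4.2 // fs3.2 // fs2.2 // fs1.2.
    rewrite /Inv big_ord_recr /= {2}/bit_heard s4S s4I !s4r !s4i.
    rewrite /= ltNge; case: ifP => _ /=; rewrite /upd /= s4P s4S s4C s4m expnS.
      by rewrite mul0n addn0; split=> //; lia.
    by rewrite mul1n; split=> //; lia.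
  + rewrite /Inv fs3.1 // s2P s3P fs3.1 // fs2.1 // s1C big_ord0; split=> //; lia.
- by move=> s' [].
Qed.

Local Notation nVOTES := (NGet iCOUNT (var iCODE)) (only parsing).

(* Counts grow by one, so a column wins its vote at the very moment when
   [K < 2 * votes <= K + 2], and is appended exactly once. *)
Definition collect : cmd :=
  For iROW nROWS
    (decode_row ;;
     If (NLe (NAdd (var iCODE) (NConst 1)) nCOLS)
       (NSet iCOUNT (var iCODE) (NAdd nVOTES (NConst 1)) ;;
        If (BAnd (NLe (NAdd nWEIGHT (NConst 1)) (NMul (NConst 2) nVOTES))
                 (NLe (NMul (NConst 2) nVOTES) (NAdd nWEIGHT (NConst 2))))
          (NSet iCAND (var iNCAND) (var iCODE) ;; incr iNCAND) Skip)
       Skip).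

Definition votes (R : realType) (m N : nat) (yr yi : nat -> R) (j n : nat) : nat :=
  \sum_(i < j) (code m N yr yi i == n).

Definition lists_winners (N K nc : nat) (cand v : nat -> nat) : Prop :=
  [/\ forall c, (c < nc)%N -> (cand c < N)%N && (K < 2 * v (cand c))%N,
      forall n, (n < N)%N -> (K < 2 * v n)%N -> exists2 c, (c < nc)%N & cand c = n &
      forall c c', (c < nc)%N -> (c' < nc)%N -> cand c = cand c' -> c = c'].

Lemma collect_runs (R : realType) (s : state R) m N K :
  nmem s 0%N 0%N = m -> nmem s 0%N 1%N = N -> nmem s 0%N 2%N = K ->
  (forall n, nmem s iCOUNT n = 0%N) -> nmem s iNCAND 0%N = 0%N ->
  runs collect s (m * (100 * up_log 2 N + 200) + 13)
    (fun s' => lists_winners N K (nmem s' iNCAND 0%N) (nmem s' iCAND)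
                 (votes m N (rmem s 0%N) (rmem s 1%N) m)).
Proof.
move=> sm sN sK sCnt sNC; set L := up_log 2 N.
set cd := code m N (rmem s 0%N) (rmem s 1%N).
set V := votes m N (rmem s 0%N) (rmem s 1%N).
pose Inv j (s' : state R) := (forall n, (n < N)%N -> nmem s' iCOUNT n = V j n) /\
  lists_winners N K (nmem s' iNCAND 0%N) (nmem s' iCAND) (V j).
apply: (@runs_weaken _ _ _ (m * ((100 * L + 50 + 80) + 2 + 11) + 2 + 11)%N _ (Inv m)).
- by lia.
- apply: runs_for => //.
  + by move=> s' fs' /=; rewrite fs'.1.
  + move=> j s1 j_m [s1Cnt [w1 w2 w3]] fs1 s1I; apply: runs_seq.
      apply: (decode_row_runs (m := m) (N := N) (i := j)) => //; by rewrite fs1.1.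
    move=> s2 s2C fs2.
    have {}s2C : nmem s2 iCODE 0%N = cd j.
      rewrite s2C /cd /code; apply: eq_bigr => b _.
      by rewrite /bit_heard !fs1.2.
    have s2Cnt n : (n < N)%N -> nmem s2 iCOUNT n = V j n by move=> ?; rewrite fs2.1 // s1Cnt.
    have s2N : nmem s2 0%N 1%N = N by rewrite fs2.1 // fs1.1.
    have s2K : nmem s2 0%N 2%N = K by rewrite fs2.1 // fs1.1.
    have s2Cand c : nmem s2 iCAND c = nmem s1 iCAND c by rewrite fs2.1.
    have s2NC : nmem s2 iNCAND 0%N = nmem s1 iNCAND 0%N by rewrite fs2.1.
    set nc := nmem s1 iNCAND 0%N in w1 w2 w3 s2NC.
    have VS n : V j.+1 n = (V j n + (cd j == n))%N by rewrite /V /votes big_ord_recr.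
    (* If no column crosses the threshold in this turn, the list stays correct. This also covers
       decoded indices beyond [N]. *)
    have same (s' : state R) : (forall n, (n < N)%N -> nmem s' iCOUNT n = V j.+1 n) ->
        nmem s' iNCAND 0%N = nc -> nmem s' iCAND =1 nmem s1 iCAND ->
        (forall n, (n < N)%N -> (K < 2 * V j.+1 n)%N = (K < 2 * V j n)%N) ->
        Inv j.+1 s'.
      move=> Cnt' NC' Cand' K'; split=> //; rewrite NC'; split=> [c|n n_N|c c'].
      + rewrite Cand' => /w1 /andP[cN ]; rewrite -K' // => ->; by rewrite cN.
      + rewrite K' // => /(w2 _ n_N)[c c_nc <-]; exists c => //.
      + by rewrite !Cand'; exact: w3.
    apply: runs_lf => //=; rewrite s2C s2N addn1; case: ifP => [cdN|cdN]; last first.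
      apply: same => //= n n_N.
        by rewrite /upd /= s2Cnt // VS; case: eqP => [cdn|]; [lia|rewrite addn0].
      by rewrite VS; case: eqP => [cdn|]; [lia|rewrite addn0].
    rewrite /= /upd /= s2C !eqxx /= s2K s2NC s2Cnt // !addn1.
    have K' n : n != cd j -> V j.+1 n = V j n.
      by rewrite VS eq_sym => /negPf ->; rewrite addn0.
    have Vcd : V j.+1 (cd j) = (V j (cd j)).+1 by rewrite VS eqxx addn1.
    have Cnt' n : (n < N)%N ->
        (if n == cd j then (V j (cd j)).+1 else nmem s2 iCOUNT n) = V j.+1 n.
      by move=> n_N; case: eqVneq => [->|/K' ->]; rewrite ?Vcd ?s2Cnt.
    case: ifP => cross; last first.
      apply: same => //= n n_N; case: (eqVneq n (cd j)) => [->|/K' -> //].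
      by rewrite Vcd; lia.
    split=> //=; rewrite /upd /= ?s2NC ?s2C; split=> [c|n n_N|c c'].
    * rewrite ltnS leq_eqVlt => /orP[/eqP->|c_nc].
        by rewrite eqxx cdN Vcd; lia.
      rewrite ifN; last by rewrite neq_ltn c_nc.
      rewrite s2Cand; have /andP[-> /=] := w1 c c_nc.
      by rewrite VS mulnDr; lia.
    * case: (eqVneq n (cd j)) => [->|n_cd].
        by exists nc => //; rewrite eqxx.
      rewrite K' // => /(w2 _ n_N)[c c_nc <-]; exists c; first by rewrite ltnS ltnW.
      by rewrite ifN ?s2Cand // neq_ltn c_nc.
    (* A column that crosses the threshold now had not won before, so it is not yet listed. *)
    * have fresh d : (d < nc)%N -> nmem s1 iCAND d != cd j.
        move=> d_nc; apply/eqP => d_cd; have /andP[_] := w1 d d_nc.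
        by rewrite d_cd; lia.
      move: w3 fresh s2Cand; clearbody nc; clear -nc => w3 fresh s2Cand.
      rewrite !ltnS !s2Cand => c_nc c'_nc.
      case: (eqVneq c nc) => [->|c_ne]; case: (eqVneq c' nc) => [->|c'_ne] //.
      - by move=> /esym cd_c'; have := fresh c'; rewrite cd_c' eqxx; lia.
      - by move=> cd_c; have := fresh c; rewrite cd_c eqxx; lia.
      - by apply: w3; lia.
  + split=> [n _|]; first by rewrite /= /upd /= sCnt /V /votes big_ord0.
    rewrite /= /upd /= sNC; split=> // n _; by rewrite /V /votes big_ord0.
- by move=> s' [].
Qed.

Definition estimate : cmd :=
  For iC (var iNCAND)
    (approx_median 0 ;; RSet rZRE (var iC) (RGet rMED (NConst 0)) ;;
     approx_median 1 ;; RSet rZIM (var iC) (RGet rMED (NConst 0)) ;;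
     RSet rMAG (var iC) (sqr_mag (RGet rZRE (var iC)) (RGet rZIM (var iC)))).

Lemma estimate_runs (R : realType) (s : state R) K nc :
  nmem s 0%N 2%N = K -> nmem s iNCAND 0%N = nc -> (0 < K)%N ->
  let a src c j := rmem s src (nmem s 1%N (nmem s iCAND c * K + j)%N) in
  runs estimate s (nc * (2 * (1000 * 100 * K + 1000) + 100) + 13)
    (fun s' => forall c, (c < nc)%N ->
       [/\ near_median (a 0%N c) K (rmem s' rZRE c),
           near_median (a 1%N c) K (rmem s' rZIM c) &
           rmem s' rMAG c = rmem s' rZRE c ^+ 2 + rmem s' rZIM c ^+ 2]).
Proof.
move=> sK sNC K_gt0 a.
pose Inv j (s' : state R) := forall c, (c < j)%N ->
       [/\ near_median (a 0%N c) K (rmem s' rZRE c),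
           near_median (a 1%N c) K (rmem s' rZIM c) &
           rmem s' rMAG c = rmem s' rZRE c ^+ 2 + rmem s' rZIM c ^+ 2].
apply: (@runs_weaken _ _ _ (nc * (((1000 * 100 * K + 1000) + (6 +
  ((1000 * 100 * K + 1000) + (6 + 20)))) + 2 + 11) + 2 + 11)%N _ (Inv nc)) => //; first by lia.
apply: runs_for => //.
- by move=> s' fs' /=; rewrite fs'.1.
move=> j s1 j_nc Ij fs1 s1C.
have medE (src : nat) (s' : state R) : nmem s' 1%N =1 nmem s 1%N ->
    nmem s' iCAND =1 nmem s iCAND -> rmem s' src =1 rmem s src ->
    (fun l => rmem s' src (nmem s' 1%N (nmem s' iCAND j * K + l)%N)) = a src j.
  by move=> H1 H2 H3; apply/funext => l; rewrite H1 H2 H3.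
apply: (@runs_seq _ _ _ _ _ _ (fun s' => near_median (a 0%N j) K (rmem s' rMED 0%N))).
  rewrite -(medE 0%N s1); try by move=> ?; rewrite ?fs1.1 ?fs1.2.
  by apply: approx_median_runs => //; rewrite fs1.1.
move=> s2 s2M fs2.
apply: (@runs_seq _ _ _ _ _ _ (fun s' => near_median (a 0%N j) K (rmem s' rZRE j) /\
    forall c, (c < j)%N -> rmem s' rZRE c = rmem s1 rZRE c)).
  apply: runs_lf => //=; rewrite /upd /= fs2.1 // s1C eqxx; split=> // c c_j.
  by rewrite ifN ?neq_ltn ?c_j // fs2.2.
move=> s3 [s3Z s3Z'] fs3.
apply: (@runs_seq _ _ _ _ _ _ (fun s' => near_median (a 1%N j) K (rmem s' rMED 0%N))).
  rewrite -(medE 1%N s3); try by move=> ?; rewrite ?fs3.1 ?fs3.2 // ?fs2.1 ?fs2.2 // ?fs1.1 ?fs1.2.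
  by apply: approx_median_runs => //; rewrite fs3.1 // fs2.1 // fs1.1.
move=> s4 s4M fs4.
apply: (@runs_seq _ _ _ _ _ _ (fun s' => near_median (a 1%N j) K (rmem s' rZIM j) /\
    forall c, (c < j)%N -> rmem s' rZIM c = rmem s1 rZIM c)).
  apply: runs_lf => //=; rewrite /upd /= fs4.1 // fs3.1 // fs2.1 // s1C eqxx; split=> // c c_j.
  by rewrite ifN ?neq_ltn ?c_j // fs4.2 // fs3.2 // fs2.2.
move=> s5 [s5Z s5Z'] fs5.
have s5C : nmem s5 iC 0%N = j by rewrite fs5.1 // fs4.1 // fs3.1 // fs2.1.
apply: runs_lf => //= c; rewrite ltnS /= /upd /= s5C => c_j.
have [->|c_ne] := eqVneq c j.
  by rewrite fs5.2 // fs4.2 // !expr2.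
have {}c_j : (c < j)%N by rewrite ltn_neqAle c_ne.
rewrite s5Z' // fs5.2 // fs4.2 // s3Z' //.
by have := Ij c c_j; rewrite fs5.2 // fs4.2 // fs3.2 // fs2.2.
Qed.

(** Magnitudes are nonnegative, so -1 serves both as the starting value of the maximum and as the
    mark of a candidate already taken. Once all are taken the remaining rounds write nothing. *)
Definition select : cmd :=
  For iROUND (NMul (NConst 2) nSPARSITY)
    (RSet rBEST (NConst 0) (RSub (RConst 0) (RConst 1)) ;;
     For iC (var iNCAND)
       (If (RLe (RGet rMAG (var iC)) (RGet rBEST (NConst 0))) Skip
          (RSet rBEST (NConst 0) (RGet rMAG (var iC)) ;; iBEST <~ var iC)) ;;
     If (RLe (RConst 0) (RGet rBEST (NConst 0)))
       (RSet 3 (NGet iCAND (var iBEST)) (RGet rZRE (var iBEST)) ;;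
        RSet 4 (NGet iCAND (var iBEST)) (RGet rZIM (var iBEST)) ;;
        RSet rMAG (var iBEST) (RSub (RConst 0) (RConst 1))) Skip).

Lemma select_runs (R : realType) (s : state R) k nc :
  nmem s 0%N 4%N = k -> nmem s iNCAND 0%N = nc ->
  (forall i, rmem s 3%N i = 0) -> (forall i, rmem s 4%N i = 0) ->
  (forall c, (c < nc)%N -> 0 <= rmem s rMAG c) ->
  (forall c c', (c < nc)%N -> (c' < nc)%N ->
     nmem s iCAND c = nmem s iCAND c' -> c = c') ->
  runs select s (2 * k * (nc * 50 + 100) + 20)
    (fun s' => exists U : {set 'I_nc}, [/\ #|U| = minn (2 * k) nc,
       (forall c, c \in U -> rmem s' 3%N (nmem s iCAND c) = rmem s rZRE c /\
                             rmem s' 4%N (nmem s iCAND c) = rmem s rZIM c),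
       (forall i, (forall c, c \in U -> nmem s iCAND c != i) ->
                  rmem s' 3%N i = 0 /\ rmem s' 4%N i = 0) &
       (forall c c', c \in U -> c' \notin U -> rmem s rMAG c' <= rmem s rMAG c)]).
Proof.
move=> sk sNC s3 s4 mag0 cand_inj.
pose Inv r (s' : state R) := exists U : {set 'I_nc},
  (forall c : 'I_nc, rmem s' rMAG c = if c \in U then -1 else rmem s rMAG c) /\
  [/\ #|U| = minn r nc,
       (forall c, c \in U -> rmem s' 3%N (nmem s iCAND c) = rmem s rZRE c /\
                             rmem s' 4%N (nmem s iCAND c) = rmem s rZIM c),
       (forall i, (forall c, c \in U -> nmem s iCAND c != i) ->
                  rmem s' 3%N i = 0 /\ rmem s' 4%N i = 0) &
       (forall c c', c \in U -> c' \notin U -> rmem s rMAG c' <= rmem s rMAG c)].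
apply: (@runs_weaken _ _ _ (2 * k * ((5 + ((nc * (20 + 2 + 11) + 2 + 11) + 40)) + 4 + 11)
  + 4 + 11)%N _ (Inv (2 * k)%N)); first by lia.
apply: runs_for => //.
- by move=> s' fs' /=; rewrite fs'.1 // sk.
- move=> r s1 r_k [U [s1M [cardU U1 U2 U3]]] fs1 _.
  apply: (@runs_seq _ _ _ _ _ _ (fun s' => rmem s' rBEST 0%N = -1)).
    by apply: runs_lf => //=; rewrite /upd /= sub0r.
  move=> s2 s2B fs2.
  pose Inv2 j (s' : state R) := (forall c, (c < j)%N -> rmem s1 rMAG c <= rmem s' rBEST 0%N) /\
    (rmem s' rBEST 0%N = -1 \/ (nmem s' iBEST 0%N < j)%N /\
       rmem s' rBEST 0%N = rmem s1 rMAG (nmem s' iBEST 0%N)).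
  apply: (@runs_seq _ _ _ _ _ _ (Inv2 nc)).
    apply: runs_for => //.
    + by move=> s' fs' /=; rewrite fs'.1 // fs2.1 // fs1.1.
    + move=> j s5 j_nc [M1 M2] fs5 s5C; apply: runs_lf => //=.
      have s5M : rmem s5 rMAG j = rmem s1 rMAG j by rewrite fs5.2 // fs2.2.
      rewrite s5C s5M; case: lerP => [le_best|gt_best]; rewrite /Inv2 /= /upd /=.
        split; last by case: M2 => [->|[b_j ->]]; [left|right; rewrite ltnS ltnW].
        by move=> c; rewrite ltnS leq_eqVlt => /orP[/eqP->|/M1].
      split; last by right.
      move=> c; rewrite ltnS leq_eqVlt => /orP[/eqP->//|/M1 cb].
      exact: le_trans cb (ltW gt_best).
    + by split=> //; left.
  move=> s5 [M1 M2] fs5; apply: runs_lf => //=.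
  have s5B (c : nat) : nmem s5 iCAND c = nmem s iCAND c by rewrite fs5.1 // fs2.1 // fs1.1.
  have s5R c : rmem s5 rZRE c = rmem s rZRE c by rewrite fs5.2 // fs2.2 // fs1.2.
  have s5I c : rmem s5 rZIM c = rmem s rZIM c by rewrite fs5.2 // fs2.2 // fs1.2.
  have s5M c : rmem s5 rMAG c = rmem s1 rMAG c by rewrite fs5.2 // fs2.2.
  have s53 c : rmem s5 3%N c = rmem s1 3%N c by rewrite fs5.2 // fs2.2.
  have s54 c : rmem s5 4%N c = rmem s1 4%N c by rewrite fs5.2 // fs2.2.
  case: ifP => [best_ge0|/negbT best_lt0]; last first.
    (* A negative maximum means that every candidate bears the mark. *)
    have UT : U = [set: 'I_nc].
      apply/setP => c; rewrite inE; apply/negPn/negP => cU.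
      have := M1 c (ltn_ord c); rewrite s1M (negPf cU) => /(le_trans (mag0 c (ltn_ord c))).
      by rewrite (negPf best_lt0).
    exists U; split=> [c|]; first by rewrite /= s5M s1M.
    split=> //.
    + by move: cardU; rewrite UT cardsT card_ord => ?; lia.
    + by move=> c cU /=; rewrite s53 s54; exact: U1.
    + by move=> i iU /=; rewrite s53 s54; exact: U2.
  have [b_nc bestE] : (nmem s5 iBEST 0%N < nc)%N /\
      rmem s5 rBEST 0%N = rmem s1 rMAG (nmem s5 iBEST 0%N).
    by case: M2 best_ge0 => // ->; rewrite oppr_ge0 ler10.
  set b := nmem s5 iBEST 0%N in b_nc bestE; pose ob := Ordinal b_nc.
  have bU : ob \notin U.
    by apply/negP => bU; move: best_ge0; rewrite bestE (s1M ob) bU oppr_ge0 ler10.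
  have U_ne (c : 'I_nc) : c \in U -> c == b :> nat = false.
    move=> cU; apply/negbTE; apply: contra bU => /eqP cb.
    by rewrite (_ : ob = c) //; apply: val_inj.
  have cand_ne (c : 'I_nc) : c \in U -> nmem s iCAND c == nmem s iCAND b = false.
    move=> cU; apply/negP => /eqP cb.
    by have := U_ne c cU; rewrite (cand_inj _ _ (ltn_ord c) b_nc cb) eqxx.
  exists (ob |: U); rewrite /= /upd /= -/b !s5B !s5R !s5I; split.
    move=> c; rewrite !inE -val_eqE /=; case: eqP => [_|_] /=; first by rewrite sub0r.
    by rewrite s5M s1M.
  split.
  + rewrite cardsU1 bU cardU; have := max_card (mem (ob |: U)).
    by rewrite cardsU1 bU cardU card_ord; lia.
  + move=> c; rewrite !inE => /orP[/eqP-> /=|cU]; first by rewrite !eqxx.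
    by rewrite !cand_ne // s53 s54; exact: U1.
  + move=> i iU.
    have /negPf ib : i != nmem s iCAND b.
      by rewrite eq_sym; apply: (iU ob); rewrite setU11.
    by rewrite !ib s53 s54; apply: U2 => c cU; apply: iU; rewrite inE cU orbT.
  + move=> c c'; rewrite !inE negb_or => /orP[/eqP->|cU] /andP[c'b c'U]; last exact: U3.
    have := M1 c' (ltn_ord c'); rewrite bestE s1M (negPf c'U) (s1M ob) (negPf bU) //.
- exists finset.set0; split; first by move=> c; rewrite inE.
  split=> [|c|i _|c c']; rewrite ?cards0 ?min0n ?inE //=.
- by move=> s' [U [_ ?]] _; exists U.
Qed.

(** Each of the [m] rows votes for at most one winner, and each winner has more than [K / 2]
    votes. *)
Lemma winners_bound (R : realType) m N K nc (yr yi : nat -> R) (cand : nat -> nat) :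
  lists_winners N K nc cand (votes m N yr yi m) -> (nc * K <= 2 * m)%N.
Proof.
move=> [win _ inj].
apply: (@leq_trans (\sum_(c < nc) 2 * votes m N yr yi m (cand c))).
  rewrite -[X in (X * _)%N]card_ord -sum_nat_const; apply: leq_sum => c _.
  by apply: ltnW; have /andP[_] := win c (ltn_ord c).
rewrite -big_distrr leq_mul2l /= /votes exchange_big /= -[leqRHS]card_ord -sum1_card.
apply: leq_sum => i _; set x := code _ _ _ _ _.
rewrite (_ : (\sum_(c < nc) (x == cand c))%N = #|[set c : 'I_nc | x == cand c]|); last first.
  rewrite -sum1_card [RHS]big_mkcond; apply: eq_bigr => c _.
  by rewrite inE; case: eqP.
apply/card_le1_eqP => c c'; rewrite !inE => /eqP cE /eqP c'E.
by apply/val_inj/inj => //=; rewrite -cE -c'E.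
Qed.

Definition recover : cmd := collect ;; estimate ;; select.

(** With [nc] winners, collecting costs O(m log N), estimating O(nc K) and selecting O(k nc), up to
    linear terms. The bounds [nc * K <= 2 * m] and [4 * k <= K] reduce the last two to O(m). *)
Lemma recover_runs (R : realType) (s : state R) m N K k :
  nmem s 0%N 0%N = m -> nmem s 0%N 1%N = N -> nmem s 0%N 2%N = K -> nmem s 0%N 4%N = k ->
  (forall n, nmem s iCOUNT n = 0%N) -> nmem s iNCAND 0%N = 0%N ->
  (forall i, rmem s 3%N i = 0) -> (forall i, rmem s 4%N i = 0) ->
  (0 < K <= m)%N -> (4 * k <= K)%N ->
  let win n := (K < 2 * votes m N (rmem s 0%N) (rmem s 1%N) m n)%N in
  let a src n j := rmem s src (nmem s 1%N (n * K + j)%N) in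
  runs recover s (1000 * 1000 * (m * maxn 1 (up_log 2 N)))
    (fun s' => exists Z : {set 'I_N}, [/\ (#|Z| <= 2 * k)%N,
       (forall n, n \in Z -> [/\ win n, near_median (a 0%N n) K (rmem s' 3%N n) &
                                 near_median (a 1%N n) K (rmem s' 4%N n)]),
       (forall n : 'I_N, n \notin Z -> rmem s' 3%N n = 0 /\ rmem s' 4%N n = 0) &
       (forall n : 'I_N, n \notin Z -> win n -> #|Z| = (2 * k)%N /\
          exists zr zi, [/\ near_median (a 0%N n) K zr, near_median (a 1%N n) K zi &
            forall j, j \in Z ->
              zr ^+ 2 + zi ^+ 2 <= rmem s' 3%N j ^+ 2 + rmem s' 4%N j ^+ 2])]).
Proof.
move=> sm sN sK sk sCnt sNC s3 s4 /andP[K_gt0 K_m] k_K win a.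
set X := maxn 1 (up_log 2 N).
have [t1 [s1 [e1 t1T w1]]] := collect_runs sm sN sK sCnt sNC.
have fs1 := exec_frame e1.
set nc := nmem s1 iNCAND 0%N in w1.
have ncK := winners_bound w1.
have s1K : nmem s1 0%N 2%N = K by rewrite fs1.1.
have [t2 [s2 [e2 t2T est]]] := estimate_runs s1K (erefl nc) K_gt0.
have fs2 := exec_frame e2.
have s2NC : nmem s2 iNCAND 0%N = nc by rewrite fs2.1.
have s2k : nmem s2 0%N 4%N = k by rewrite fs2.1 // fs1.1.
have candE c : nmem s2 iCAND c = nmem s1 iCAND c by rewrite fs2.1.
have [win1 win2 inj] := w1.
have aE src n : src \notin rmods collect ->
    (fun j => rmem s1 src (nmem s1 1%N (n * K + j)%N)) = a src n.
  by move=> src_ok; apply/funext => j; rewrite fs1.1 // fs1.2.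
have s23 i : rmem s2 3%N i = 0 by rewrite fs2.2 // fs1.2.
have s24 i : rmem s2 4%N i = 0 by rewrite fs2.2 // fs1.2.
have s2M c : (c < nc)%N -> 0 <= rmem s2 rMAG c.
  by move=> c_nc; have [_ _ ->] := est c c_nc; rewrite addr_ge0 ?sqr_ge0.
have inj2 c c' : (c < nc)%N -> (c' < nc)%N ->
    nmem s2 iCAND c = nmem s2 iCAND c' -> c = c' by rewrite !candE; exact: inj.
have [t3 [s4' [e3 t3T [U [cardU U1 U2 U3]]]]] := select_runs s2k s2NC s23 s24 s2M inj2.
exists (t1 + (t2 + t3))%N, s4'; split.
- exact: ExecSeq e1 (ExecSeq e2 e3).
- have LX : (up_log 2 N <= X)%N by rewrite leq_maxr.
  have X_gt0 : (0 < X)%N by rewrite leq_max.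
  have h1 := leq_mul (leqnn m) LX; have h2 := leq_mul (leqnn m) X_gt0.
  have h3 : (nc <= nc * K)%N by rewrite leq_pmulr.
  have h4 := leq_mul (leqnn nc) k_K.
  move: (m * X)%N h1 h2 => mX h1 h2.
  have h5 : (2 * k * (nc * 50 + 100) = 25 * (nc * (4 * k)) + 200 * k)%N by ring.
  have h6 : (nc * (2 * (1000 * 100 * K + 1000) + 100) =
             1000 * 200 * (nc * K) + 2100 * nc)%N by ring.
  have h7 : (m * (100 * up_log 2 N + 200) = 100 * (m * up_log 2 N) + 200 * m)%N by ring.
  lia.
have candN (c : 'I_nc) : (nmem s1 iCAND c < N)%N by have /andP[] := win1 c (ltn_ord c).
pose f c := Ordinal (candN c).
have f_inj : injective f by move=> c c' /(congr1 val) /= fc; apply: val_inj; exact: inj fc.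
have fU3 (c : 'I_nc) : c \in U -> rmem s4' 3%N (f c) = rmem s2 rZRE c /\
    rmem s4' 4%N (f c) = rmem s2 rZIM c.
  by move=> /U1; rewrite candE.
have med c : (c < nc)%N ->
    near_median (a 0%N (nmem s1 iCAND c)) K (rmem s2 rZRE c) /\
    near_median (a 1%N (nmem s1 iCAND c)) K (rmem s2 rZIM c).
  by move=> c_nc; have [] := est c c_nc; rewrite !aE.
exists (f @: U); rewrite card_imset // cardU; split.
- by lia.
- move=> _ /imsetP[c cU ->]; have [-> ->] := fU3 c cU.
  by have [? ?] := med c (ltn_ord c); have /andP[_ ?] := win1 c (ltn_ord c); split.
- move=> n nU; apply: U2 => c cU; rewrite candE; apply: contraNneq nU => nE.
  by apply/imsetP; exists c => //; apply: val_inj; rewrite /= nE.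
- move=> n nU wn; have [c c_nc cn] := win2 n (ltn_ord n) wn.
  have cU : Ordinal c_nc \notin U.
    apply: contra nU => cU; apply/imsetP; exists (Ordinal c_nc) => //.
    by apply: val_inj; rewrite /= cn.
  split.
    (* A winner left out shows that [U] is not everything, so the minimum of [2 * k] and [nc] is
       [2 * k]. *)
    have : (0 < #|~: U|)%N by apply/card_gt0P; exists (Ordinal c_nc); rewrite inE.
    by have := cardsC U; rewrite card_ord cardU; lia.
  exists (rmem s2 rZRE c), (rmem s2 rZIM c); have [] := med c c_nc; rewrite cn => ? ?; split=> //.
  move=> _ /imsetP[c' c'U ->]; have [-> ->] := fU3 c' c'U.
  have [_ _ <-] := est c c_nc; have [_ _ <-] := est c' (ltn_ord c').
  exact: U3 c'U cU.
Qed.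

(** * Recovery error *)

Lemma cabs_ge0 (R : realType) (z : R[i]) : 0 <= cabs z.
Proof. by case: z => a b; exact: sqrtr_ge0. Qed.

Lemma cabs0 (R : realType) : cabs (0 : R[i]) = 0.
Proof. exact: Normc.normc0. Qed.

Lemma cabs_sqr (R : realType) (z : R[i]) :
  cabs z ^+ 2 = complex.Re z ^+ 2 + complex.Im z ^+ 2.
Proof. by case: z => a b; rewrite sqr_sqrtr // addr_ge0 ?sqr_ge0. Qed.

Lemma cabs_real (R : realType) (a : R) : cabs a%:C = `|a|.
Proof. by rewrite /= expr0n addr0 sqrtr_sqr. Qed.

Lemma cabs_sum (R : realType) (I : Type) (r : seq I) (P : pred I) (F : I -> R[i]) :
  cabs (\sum_(i <- r | P i) F i) <= \sum_(i <- r | P i) cabs (F i).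
Proof.
elim/big_ind2: _ => [|a b c d ab cd|//]; first by rewrite cabs0.
by apply: le_trans (le_normcD _ _) _; apply: lerD.
Qed.

Lemma cabs_Re (R : realType) (z : R[i]) : `|complex.Re z| <= cabs z.
Proof. by case: z => a b /=; rewrite -sqrtr_sqr ler_wsqrtr // lerDl sqr_ge0. Qed.

Lemma cabs_Im (R : realType) (z : R[i]) : `|complex.Im z| <= cabs z.
Proof. by case: z => a b /=; rewrite -sqrtr_sqr ler_wsqrtr // lerDr sqr_ge0. Qed.

Lemma lpnorm1E (R : realType) n (x : 'cV[R[i]]_n) : lpnorm 1 x = \sum_i cabs (x i 0).
Proof.
rewrite /lpnorm invr1 powRr1; last by apply: sumr_ge0 => i _; exact: powR_ge0.
by apply: eq_bigr => i _; rewrite powRr1 // cabs_ge0.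
Qed.

Lemma lpnorm2E (R : realType) n (x : 'cV[R[i]]_n) :
  lpnorm 2 x = Num.sqrt (\sum_i cabs (x i 0) ^+ 2).
Proof.
rewrite /lpnorm powR12_sqrt; last by apply: sumr_ge0 => i _; exact: powR_ge0.
by congr Num.sqrt; apply: eq_bigr => i _; rewrite powR_mulrn // cabs_ge0.
Qed.

Lemma lpnorm_powR (R : realType) n (p : R) (x : 'cV[R[i]]_n) :
  p != 0 -> lpnorm p x `^ p = \sum_i cabs (x i 0) `^ p.
Proof.
move=> p0; rewrite /lpnorm -powRrM mulVf // powRr1 //.
by apply: sumr_ge0 => i _; exact: powR_ge0.
Qed.

Lemma sqrtrD_le (R : realType) (a b : R) :
  0 <= a -> 0 <= b -> Num.sqrt (a + b) <= Num.sqrt a + Num.sqrt b.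
Proof.
move=> a0 b0; rewrite -(ler_pXn2r (_ : (0 < 2)%N)) ?nnegrE ?addr_ge0 ?sqrtr_ge0 //.
rewrite sqr_sqrtr ?addr_ge0 // sqrrD !sqr_sqrtr //.
by rewrite addrAC lerDl mulrn_wge0 // mulr_ge0 ?sqrtr_ge0.
Qed.

(* Minkowski for the two vectors (a, s mu) and (0, s d) of the plane. *)
Lemma sqrtr_shift_le (R : realType) (a s mu d : R) :
  0 <= s -> 0 <= mu -> 0 <= d ->
  Num.sqrt (a ^+ 2 + (s * (mu + d)) ^+ 2) <= Num.sqrt (a ^+ 2 + (s * mu) ^+ 2) + s * d.
Proof.
move=> s0 mu0 d0; set r := Num.sqrt (a ^+ 2 + (s * mu) ^+ 2).
have r0 : 0 <= r by exact: sqrtr_ge0.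
have r2 : r ^+ 2 = a ^+ 2 + (s * mu) ^+ 2 by rewrite sqr_sqrtr ?addr_ge0 ?sqr_ge0.
have smu : s * mu <= r.
  rewrite -[s * mu]ger0_norm ?mulr_ge0 // -sqrtr_sqr ler_wsqrtr //.
  by rewrite lerDr sqr_ge0.
have sd : 0 <= s * d by exact: mulr_ge0.
rewrite -[leRHS]ger0_norm ?addr_ge0 // -sqrtr_sqr ler_wsqrtr //.
rewrite mulrDr !sqrrD r2; have := ler_wpM2r sd smu; lra.
Qed.

(** Here [u] holds the moduli of the signal, [H] its head and [Z] the kept columns. A missed head
    entry is at most [mu + 2 * e], where [mu] is the least modulus in [Z :\: H], or 0 when all
    missed entries are at most [2 * e]. As [Z :\: H] is at least as large as [H :\: Z], the terms
    [mu ^+ 2] are paid for by the tail. What remains is [2 * e] on [H :\: Z] and [e] on [Z]. *)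
Lemma recovery_error (R : realType) (N k : nat) (u err : 'I_N -> R) (H Z : {set 'I_N})
    (e : R) :
  0 <= e -> (forall n, 0 <= u n) ->
  (#|H| <= k)%N -> (#|Z| <= 2 * k)%N ->
  (forall n, n \in Z -> 0 <= err n <= e) -> (forall n, n \notin Z -> err n = u n) ->
  (forall n, n \notin Z -> u n <= 2 * e \/
     #|Z| = (2 * k)%N /\ forall j, j \in Z -> u n <= u j + 2 * e) ->
  Num.sqrt (\sum_n err n ^+ 2) <=
    Num.sqrt (\sum_(n | n \notin H) u n ^+ 2) + (2 + 3 / 2) * e * Num.sqrt k%:R.
Proof.
move=> e0 u0 Hk Zk errZ errN unZ.
pose q := #|H :\: Z|.
have [mu [mu0 q_mu u_mu]] : exists mu : R, [/\ 0 <= mu,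
    q%:R * mu ^+ 2 <= \sum_(n in Z :\: H) u n ^+ 2 &
    forall n, n \in H :\: Z -> u n <= mu + 2 * e].
  have [small|] := boolP [forall n in H :\: Z, u n <= 2 * e].
    exists 0; split=> //; first by rewrite expr0n mulr0 sumr_ge0 // => n _; exact: sqr_ge0.
    by move=> n nHZ; rewrite add0r; exact: (forall_inP small).
  rewrite negb_forall_in => /exists_inP[n0]; rewrite -ltNge => n0HZ big.
  have [n0Z n0H] : n0 \notin Z /\ n0 \in H by move: n0HZ; rewrite inE => /andP[].
  have cardZ : #|Z| = (2 * k)%N by case: (unZ n0 n0Z) => [|[]//]; rewrite leNgt big.
  have q_gt0 : (0 < q)%N by apply/card_gt0P; exists n0.
  (* Since [Z] has [2 * k] elements and [H] at most [k], [Z :\: H] is the larger difference. *)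
  have q_le : (q <= #|Z :\: H|)%N.
    by have := cardsID Z H; have := cardsID H Z; rewrite finset.setIC -/q; lia.
  have [j0 j0ZH] : exists j, j \in Z :\: H by apply/card_gt0P; exact: leq_trans q_le.
  have [j jZH jmin] := @arg_minP _ _ _ j0 (mem (Z :\: H)) u j0ZH.
  have {}jZH : j \in Z :\: H by [].
  exists (u j); split=> //.
    apply: (@le_trans _ _ (#|Z :\: H|%:R * u j ^+ 2)).
      by rewrite ler_wpM2r ?sqr_ge0 // ler_nat.
    rewrite -[X in X%:R]sum1_card natr_sum mulr_suml; apply: ler_sum => i iZH.
    by rewrite mul1r ler_sqr ?nnegrE //; exact: jmin.
  move=> n; rewrite inE => /andP[nZ nH].
  case: (unZ n nZ) => [le2e|[_ lej]]; first by apply: le_trans le2e _; rewrite lerDr.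
  by apply: lej; move: jZH; rewrite inE => /andP[].
set a2 := \sum_(n | (n \notin Z) && (n \notin H)) u n ^+ 2.
have a20 : 0 <= a2 by apply: sumr_ge0 => n _; exact: sqr_ge0.
have tail : \sum_(n | n \notin H) u n ^+ 2 = a2 + \sum_(n in Z :\: H) u n ^+ 2.
  rewrite (bigID [in Z]) /= addrC; congr (_ + _).
    by apply: eq_bigl => n; rewrite andbC.
  by apply: eq_bigl => n; rewrite !inE.
have errs : \sum_n err n ^+ 2 <= (a2 + q%:R * (mu + 2 * e) ^+ 2) + (2 * k)%:R * e ^+ 2.
  rewrite (bigID [in Z]) /= addrC; apply: lerD.
    rewrite (bigID [in H]) /= addrC; apply: lerD.
      rewrite le_eqVlt; apply/orP; left; apply/eqP.
      by apply: eq_bigr => n /andP[nZ _]; rewrite errN.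
    rewrite -[X in X%:R]sum1_card natr_sum mulr_suml.
    rewrite [leRHS](eq_bigl (fun n => (n \notin Z) && (n \in H))); last by move=> n; rewrite inE.
    apply: ler_sum => n nHZ; rewrite mul1r errN; last by case/andP: nHZ.
    by rewrite ler_sqr ?nnegrE ?addr_ge0 ?mulr_ge0 // u_mu // inE.
  apply: (@le_trans _ _ (#|Z|%:R * e ^+ 2)); last by rewrite ler_wpM2r ?sqr_ge0 // ler_nat.
  rewrite -[X in X%:R]sum1_card natr_sum mulr_suml; apply: ler_sum => n nZ.
  by have /andP[h0 h1] := errZ n nZ; rewrite mul1r ler_sqr ?nnegrE.
have qk : Num.sqrt q%:R <= Num.sqrt (k%:R : R).
  rewrite ler_wsqrtr // ler_nat; apply: leq_trans Hk; exact: subset_leq_card (subsetDl _ _).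
have sq2 : Num.sqrt (q%:R : R) ^+ 2 = q%:R by rewrite sqr_sqrtr.
have := ler_wsqrtr errs; move/le_trans; apply.
apply: (le_trans (sqrtrD_le _ _)).
- by rewrite addr_ge0 // mulr_ge0 // sqr_ge0.
- by rewrite mulr_ge0 // sqr_ge0.
have -> : a2 + q%:R * (mu + 2 * e) ^+ 2 =
    Num.sqrt a2 ^+ 2 + (Num.sqrt q%:R * (mu + 2 * e)) ^+ 2.
  by rewrite exprMn sq2 sqr_sqrtr.
have h1 := @sqrtr_shift_le _ (Num.sqrt a2) (Num.sqrt q%:R) mu (2 * e)
  (sqrtr_ge0 _) mu0 (mulr_ge0 (ler0n _ 2) e0).
have h2 : Num.sqrt (Num.sqrt a2 ^+ 2 + (Num.sqrt q%:R * mu) ^+ 2) <=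
    Num.sqrt (\sum_(n | n \notin H) u n ^+ 2).
  by rewrite ler_wsqrtr // tail exprMn sq2 sqr_sqrtr // lerD2l.
(* The factor 3/2 bounds the square root of 2. *)
have h3 : Num.sqrt ((2 * k)%:R * e ^+ 2) <= 3 / 2 * e * Num.sqrt k%:R.
  rewrite natrM -mulrA [_ * e ^+ 2]mulrC mulrA sqrtrM ?mulr_ge0 ?sqr_ge0 //.
  rewrite sqrtrM // sqrtr_sqr ger0_norm // ler_wpM2r ?sqrtr_ge0 // ler_wpM2r //.
  rewrite -[leRHS]ger0_norm; last by lra.
  by rewrite -sqrtr_sqr ler_wsqrtr //; lra.
have h4 : Num.sqrt q%:R * (2 * e) <= 2 * e * Num.sqrt k%:R.
  by rewrite mulrC ler_wpM2l // mulr_ge0.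
lra.
Qed.

(** * From measurements to votes and estimates *)

Lemma sum_bits (n L : nat) :
  (\sum_(b < L) odd (n %/ 2 ^ b) * 2 ^ b)%N = (n %% 2 ^ L)%N.
Proof.
elim: L => [|L IHL]; first by rewrite big_ord0 expn0 modn1.
rewrite big_ord_recr /= IHL.
have P_gt0 : (0 < 2 ^ L)%N by rewrite expn_gt0.
have nE : n = ((n %/ 2 ^ L)./2 * 2 ^ L.+1 + (n %% 2 ^ L + odd (n %/ 2 ^ L) * 2 ^ L))%N.
  rewrite {1}(divn_eq n (2 ^ L)) -{1}(odd_double_half (n %/ 2 ^ L)) -muln2 expnS.
  by ring.
apply/esym; rewrite {1}nE modnMDl modn_small // expnS mul2n -addnn.
have := ltn_pmod n P_gt0; case: odd; rewrite ?mul1n ?mul0n ?addn0 => ?; first by rewrite ltn_add2r.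
by apply: ltn_addr.
Qed.

(** The index [b = 0] stands for the all-ones row of the bit test matrix, and [b.+1] for the test of
    bit [b]. *)
Definition pooled (R : realType) (m N : nat) (M : 'M[bool]_(m, N)) (x : 'cV[R[i]]_N)
    (i : 'I_m) (b : nat) : R[i] :=
  \sum_(j | M i j && ((b == 0%N) || odd (j %/ 2 ^ b.-1))) x j 0.

Lemma measurementE (R : realType) (m N K alpha k : nat) (eps : R) (M : 'M[bool]_(m, N))
    (T : 'M['I_m]_(K, N)) (x : 'cV[R[i]]_N) (i : 'I_m) (b : nat) :
  (b <= up_log 2 N)%N ->
  let s := input alpha k eps T (row_tensor (bin_mx R M) (bit_test R[i] N) *m x) in
  rmem s 0%N (i + m * b)%N = complex.Re (pooled M x i b) /\
  rmem s 1%N (i + m * b)%N = complex.Im (pooled M x i b).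
Proof.
move=> bL s; rewrite /s /=.
have idx_lt : (i + m * b < m * (up_log 2 N).+1)%N.
  apply: (@leq_trans (m * b.+1)); last by rewrite leq_mul2l ltnS bL orbT.
  by rewrite mulnS ltn_add2r.
have m_gt0 : (0 < m)%N by exact: leq_ltn_trans (ltn_ord i).
case: insubP => [idx _ idxE|]; last by rewrite idx_lt.
suff -> : (row_tensor (bin_mx R M) (bit_test R[i] N) *m x) idx 0 = pooled M x i b by [].
rewrite mxE /pooled [RHS]big_mkcond; apply: eq_bigr => j _; rewrite !mxE.
have -> : Ordinal (rowmod_subproof idx) = i.
  by apply: val_inj; rewrite /= idxE addnC mulnC modnMDl modn_small.
rewrite /= idxE addnC mulnC divnMDl // divn_small // addn0.
case: (M i j); rewrite ?mul0r //= mul1r.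
by case: b {idx_lt idxE bL} => [|b] /=; rewrite ?mul1r //; case: odd; rewrite ?mul1r ?mul0r.
Qed.

Definition noise (R : realType) (m N : nat) (M : 'M[bool]_(m, N)) (x : 'cV[R[i]]_N)
    (i : 'I_m) (n : 'I_N) : R :=
  \sum_(j | M i j && (j != n)) cabs (x j 0).

Lemma pooled0_near (R : realType) (m N : nat) (M : 'M[bool]_(m, N)) (x : 'cV[R[i]]_N) i n :
  M i n -> cabs (pooled M x i 0 - x n 0) <= noise M x i n.
Proof.
move=> Min; rewrite /pooled (bigD1 n) ?Min //= addrAC subrr add0r.
apply: le_trans (cabs_sum _ _ _) _; rewrite le_eqVlt; apply/orP; left; apply/eqP.
by apply: eq_bigl => j; rewrite andbT.
Qed.

Lemma cabs_ltE (R : realType) (z t : R[i]) :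
  (cabs z < cabs t) = (complex.Re z * complex.Re z + complex.Im z * complex.Im z <
                       complex.Re t * complex.Re t + complex.Im t * complex.Im t).
Proof. by rewrite -!expr2 -!cabs_sqr ltr_pXn2r ?nnegrE ?cabs_ge0. Qed.

(** The bit splits the columns of the row in two classes. The class of [n] sums to at least
    [cabs (x n 0)] minus its own noise, the other to at most its noise. Both noises together stay
    below [cabs (x n 0)], so the class of [n] is the louder. *)
Lemma bit_heardE (R : realType) (m N : nat) (M : 'M[bool]_(m, N)) (x : 'cV[R[i]]_N)
    (yr yi : nat -> R) (i : 'I_m) (n : 'I_N) (b : nat) :
  (forall c, (c <= up_log 2 N)%N -> yr (i + m * c)%N = complex.Re (pooled M x i c) /\
                                    yi (i + m * c)%N = complex.Im (pooled M x i c)) ->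
  M i n -> noise M x i n < cabs (x n 0) -> (b < up_log 2 N)%N ->
  bit_heard m yr yi i b = odd (n %/ 2 ^ b).
Proof.
move=> yE Min loud bL; rewrite /bit_heard.
have [-> ->] := yE b.+1 bL; have [yr0 yi0] := yE 0%N isT; rewrite muln0 addn0 in yr0 yi0.
rewrite yr0 yi0 -[complex.Re _ - _]raddfB -[complex.Im _ - _]raddfB /= -cabs_ltE.
pose B (j : 'I_N) := odd (j %/ 2 ^ b).
have pb : pooled M x i b.+1 = \sum_(j | M i j && B j) x j 0 by [].
have p0 : pooled M x i 0 - pooled M x i b.+1 = \sum_(j | M i j && ~~ B j) x j 0.
  rewrite pb /pooled (bigID B) /=.
  under eq_bigl do rewrite andbT.
  by rewrite addrC addrK; apply: eq_bigl => j; rewrite andbT.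
have split_noise : noise M x i n = \sum_(j | (M i j && B j) && (j != n)) cabs (x j 0) +
    \sum_(j | (M i j && ~~ B j) && (j != n)) cabs (x j 0).
  rewrite /noise (bigID B) /=; congr (_ + _); apply: eq_bigl => j; rewrite -!andbA;
  by congr andb; rewrite andbC.
have side (P : pred 'I_N) : P n -> cabs (x n 0) <=
    cabs (\sum_(j | P j) x j 0) + \sum_(j | P j && (j != n)) cabs (x j 0).
  move=> Pn; rewrite (bigD1 n) //=; set e := \sum_(j | _) x j 0.
  have -> : x n 0 = (x n 0 + e) + - e by rewrite addrK.
  apply: le_trans (le_normcD _ _) _; rewrite normcN addrK lerD2l; exact: cabs_sum.
have other (P : pred 'I_N) : ~~ P n -> cabs (\sum_(j | P j) x j 0) <=
    \sum_(j | P j && (j != n)) cabs (x j 0).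
  move=> Pn; apply: le_trans (cabs_sum _ _ _) _; rewrite le_eqVlt; apply/orP; left.
  apply/eqP/eq_bigl => j; case: eqVneq => [->|]; rewrite ?andbT ?andbF //.
  exact: negbTE.
rewrite p0 pb -/(B n); case Bn: (B n).
  have := side (fun j => M i j && B j); have := other (fun j => M i j && ~~ B j).
  rewrite Min Bn /= => /(_ isT) h1 /(_ isT) h2; lra.
have := side (fun j => M i j && ~~ B j); have := other (fun j => M i j && B j).
rewrite Min Bn /= => /(_ isT) h1 /(_ isT) h2; apply/negbTE; rewrite -leNgt; lra.
Qed.

Lemma codeE (R : realType) (m N : nat) (M : 'M[bool]_(m, N)) (x : 'cV[R[i]]_N)
    (yr yi : nat -> R) (i : 'I_m) (n : 'I_N) :
  (forall c, (c <= up_log 2 N)%N -> yr (i + m * c)%N = complex.Re (pooled M x i c) /\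
                                    yi (i + m * c)%N = complex.Im (pooled M x i c)) ->
  M i n -> noise M x i n < cabs (x n 0) -> code m N yr yi i = n.
Proof.
move=> yE Min loud; rewrite /code.
under eq_bigr => b _ do rewrite (bit_heardE yE Min loud (ltn_ord b)).
rewrite sum_bits modn_small //; apply: leq_trans (ltn_ord n) _.
exact: up_logP.
Qed.

(** If one chosen row carried a zero, all the ones of the column, at least [K] of them, would lie in
    the other [K - 1] chosen rows. *)
Lemma largest_rows_ones (m N K : nat) (M : 'M[bool]_(m, N)) (T : 'M['I_m]_(K, N)) n a :
  largest_rows M T -> (K <= #|[set i | M i n]|)%N -> M (T a n) n.
Proof.
move=> /(_ n)[T_inj T_max] KM; apply/negPn/negP => Mn.
have : (#|[set i | M i n]| <= #|[set T b n | b in [set~ a]]|)%N.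
  apply/subset_leq_card/fintype.subsetP => i; rewrite inE => Min.
  apply/imsetP; have [[b ib]|noT] := pselect (exists b, i = T b n).
    by exists b => //; rewrite !inE; apply: contraNneq Mn => <-; rewrite -ib.
  have /(T_max a) : forall b, T b n != i by move=> b; apply/eqP => bi; apply: noT; exists b.
  by rewrite Min (negPf Mn).
rewrite card_imset // cardsC1 card_ord => /(leq_trans KM).
by have := ltn_ord a; lia.
Qed.

Lemma cardE_sum (I : finType) (P : pred I) : #|[set i | P i]| = (\sum_i P i)%N.
Proof.
rewrite -sum1_card big_mkcond; apply: eq_bigr => i _; rewrite inE; by case: (P i).
Qed.

Lemma shared_rows (m N K alpha : nat) (M : 'M[bool]_(m, N)) (T : 'M['I_m]_(K, N)) n j :
  coherent_bin K alpha M -> largest_rows M T -> j != n ->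
  (#|[set a | M (T a n) j]| <= alpha)%N.
Proof.
move=> [_ _ weight coh] TM jn.
apply: leq_trans (coh n j _); last by rewrite eq_sym.
have -> : (\sum_i M i n * M i j)%N = #|[set i | M i n && M i j]|.
  by rewrite cardE_sum; apply: eq_bigr => i _; case: (M i n); rewrite ?mul1n ?mul0n.
rewrite -(card_imset _ (TM n).1); apply/subset_leq_card/fintype.subsetP => _ /imsetP[a + ->].
by rewrite !inE => ->; rewrite (largest_rows_ones _ TM).
Qed.

Lemma few_noisy_rows (R : realType) (m N K alpha : nat) (M : 'M[bool]_(m, N))
    (T : 'M['I_m]_(K, N)) (x : 'cV[R[i]]_N) (S : {set 'I_N}) (n : 'I_N) (delta : R) :
  coherent_bin K alpha M -> largest_rows M T -> (4 * (#|S| * alpha) < K)%N ->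
  delta = 16 * alpha%:R * (\sum_(j | j \notin S) cabs (x j 0)) / K%:R ->
  (16 * #|[set a | (delta < noise M x (T a n) n)%R]| < 5 * K)%N.
Proof.
move=> coh TM SK; set tau := \sum_(j | _) _ => deltaE.
have [/andP[K_gt0 _] /andP[alpha_gt0 _] weight _] := coh.
have tau0 : 0 <= tau by apply: sumr_ge0 => j _; exact: cabs_ge0.
(* A noisy row either meets another column of the head, or its tail alone exceeds [delta]. The first
   kind is below K/4, the second at most K/16. *)
pose B1 := [set a | [exists j in S, (j != n) && M (T a n) j]].
pose tail a := \sum_(j | M (T a n) j && (j != n) && (j \notin S)) cabs (x j 0).
pose B2 := [set a | (delta < tail a)%R].
have cardB1 : (#|B1| <= #|S| * alpha)%N.
  apply: (@leq_trans (\sum_(a in B1) \sum_(j in S | j != n) M (T a n) j)).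
    rewrite -sum1_card; apply: leq_sum => a; rewrite inE => /exists_inP[j jS /andP[jn Mj]].
    by rewrite (bigD1 j) ?jS //= Mj.
  apply: (@leq_trans (\sum_(j in S | j != n) #|[set a | M (T a n) j]|)).
    rewrite exchange_big /=; apply: leq_sum => j _; rewrite cardE_sum.
    by rewrite [leqRHS](bigID [in B1]) leq_addr.
  rewrite -sum_nat_const big_mkcondr; apply: leq_sum => j jS.
  by case: ifP => // jn; exact: shared_rows coh TM jn.
have cardB2 : (16 * #|B2| <= K)%N.
  have [->|/set0Pn[a0 a0B2]] := eqVneq B2 finset.set0; first by rewrite cards0.
  (* With a vanishing tail [delta] is 0 and no row exceeds it. *)
  have tau_gt0 : 0 < tau.
    rewrite lt_neqAle tau0 andbT; apply/eqP => tauE.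
    move: a0B2; rewrite inE deltaE -tauE mulr0 mul0r ltNge.
    apply/negP/negPn; rewrite tauE /tail /tau [leRHS](bigID (fun j => M (T a0 n) j && (j != n))) /=.
    rewrite [in leRHS](eq_bigl (fun j => M (T a0 n) j && (j != n) && (j \notin S))) /=; last first.
      by move=> j; rewrite andbC.
    by rewrite lerDl sumr_ge0 // => j _; exact: cabs_ge0.
  (* Markov's inequality: another column shares at most [alpha] of these rows, so each tail entry is
     counted at most [alpha] times. *)
  have H1 : #|B2|%:R * delta <= alpha%:R * tau.
    apply: (@le_trans _ _ (\sum_(a in B2) tail a)).
      rewrite -sum1_card natr_sum mulr_suml; apply: ler_sum => a; rewrite inE => aB.
      by rewrite mul1r ltW.
    apply: (@le_trans _ _ (\sum_a tail a)).
      rewrite [leRHS](bigID [in B2]) /= lerDl; apply: sumr_ge0 => a _.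
      by apply: sumr_ge0 => j _; exact: cabs_ge0.
    rewrite (eq_bigr (fun a => \sum_(j | (j \notin S) && (j != n))
        (M (T a n) j)%:R * cabs (x j 0))); last first.
      move=> a _; rewrite /tail [LHS]big_mkcond [RHS]big_mkcond; apply: eq_bigr => j _.
      by case: (M _ _); case: (j != n); case: (j \notin S); rewrite /= ?mul1r ?mul0r.
    rewrite exchange_big /= mulr_sumr.
    apply: (@le_trans _ _ (\sum_(j | (j \notin S) && (j != n)) alpha%:R * cabs (x j 0))).
      apply: ler_sum => j /andP[_ jn]; rewrite -mulr_suml ler_wpM2r ?cabs_ge0 //.
      rewrite -natr_sum ler_nat -cardE_sum; exact: shared_rows coh TM jn.
    rewrite [leRHS](bigID (fun j => j != n)) /= lerDl; apply: sumr_ge0 => j _.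
    by rewrite mulr_ge0 ?cabs_ge0.
  have at_gt0 : 0 < alpha%:R * tau by rewrite mulr_gt0 // ltr0n.
  have KR : (0 : R) < K%:R by rewrite ltr0n.
  have H2 : (#|B2|%:R * 16 / K%:R) * (alpha%:R * tau) <= 1 * (alpha%:R * tau).
    rewrite mul1r; apply: le_trans H1; rewrite deltaE le_eqVlt; apply/orP; left.
    by apply/eqP; ring.
  move: H2; rewrite ler_pM2r // ler_pdivrMr // mul1r -natrM ler_nat mulnC //.
have sub : [set a | (delta < noise M x (T a n) n)%R] \subset B1 :|: B2.
  apply/fintype.subsetP => a; rewrite !inE => noisy; apply/orP.
  have [|clean] := boolP [exists j in S, (j != n) && M (T a n) j]; first by left.
  right; apply: lt_le_trans noisy _; rewrite le_eqVlt; apply/orP; left; apply/eqP.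
  apply: eq_bigl => j; case: (boolP (j \in S)) => jS /=; last by rewrite andbT.
  rewrite andbF; apply/negbTE; apply: contra clean => /andP[Mj jn].
  by apply/exists_inP; exists j => //; rewrite jn.
have := subset_leq_card sub; have := cardsUI B1 B2.
move: cardB1 cardB2; set b1 := #|B1|; set b2 := #|B2|; set b := #|[set a | _]|; lia.
Qed.

(** Neither the entries up to [v] nor those from [v] on can all be bad, so [v] lies between two
    values that are [delta]-close to [c]. *)
Lemma near_median_close (R : realType) (f : nat -> R) (K : nat) (v c delta : R)
    (bad : {set 'I_K}) :
  near_median f K v -> (16 * #|bad| < 5 * K)%N ->
  (forall a, a \notin bad -> `|f a - c| <= delta) -> `|v - c| <= delta.
Proof.
move=> [lo hi] few good.
have pick (P : pred R) : (5 * K <= 16 * tally P f K)%N -> exists2 a, a \notin bad & P (f a).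
  move=> big; have [//|no] := pselect (exists2 a, a \notin bad & P (f a)).
  have : (tally P f K <= #|bad|)%N.
    rewrite /tally -(@cardE_sum _ (fun a : 'I_K => P (f a))).
    apply/subset_leq_card/fintype.subsetP => a; rewrite inE => Pa.
    by apply/negPn/negP => a_bad; apply: no; exists a.
  by lia.
have [a /good a_good /= av] := pick _ lo; have [b /good b_good /= vb] := pick _ hi.
move: a_good b_good; rewrite !ler_norml => /andP[? ?] /andP[? ?]; apply/andP; split; lra.
Qed.

Lemma input_row (R : realType) (m N q K alpha k : nat) (eps : R) (T : 'M['I_m]_(K, N))
    (y : 'cV[R[i]]_q) (n : 'I_N) (a : 'I_K) :
  nmem (input alpha k eps T y) 1%N (n * K + a)%N = T a n.
Proof.
have K_gt0 : (0 < K)%N by exact: leq_ltn_trans (ltn_ord a).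
rewrite /= divnMDl // divn_small // addn0 modnMDl modn_small //.
by case: insubP => [n' _ /val_inj ->|]; [case: insubP => [a' _ /val_inj -> //|]|]; rewrite ltn_ord.
Qed.

(** More than 11/16 of the chosen rows are quiet, and each of them decodes to [n]; half would be
    enough. *)
Lemma votes_loud (R : realType) (m N K alpha : nat) (M : 'M[bool]_(m, N))
    (T : 'M['I_m]_(K, N)) (x : 'cV[R[i]]_N) (yr yi : nat -> R) (n : 'I_N) (delta : R) :
  coherent_bin K alpha M -> largest_rows M T ->
  (forall (i : 'I_m) c, (c <= up_log 2 N)%N ->
     yr (i + m * c)%N = complex.Re (pooled M x i c) /\
     yi (i + m * c)%N = complex.Im (pooled M x i c)) ->
  (16 * #|[set a | (delta < noise M x (T a n) n)%R]| < 5 * K)%N ->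
  delta < cabs (x n 0) -> (K < 2 * votes m N yr yi m n)%N.
Proof.
move=> [_ _ weight _] TM yE few loud; set bad := [set a | _] in few.
have sub : [set T a n | a in ~: bad] \subset [set i | code m N yr yi (val i) == n].
  apply/fintype.subsetP => _ /imsetP[a + ->]; rewrite !inE -leNgt => quiet.
  apply/eqP/(codeE (M := M) (x := x)); first exact: yE.
    exact: largest_rows_ones TM (weight n).
  exact: le_lt_trans loud.
have := subset_leq_card sub; rewrite card_imset; last exact: (TM n).1.
have <- : votes m N yr yi m n = #|[set i : 'I_m | code m N yr yi (val i) == n]|.
  by rewrite cardE_sum.
by have := cardsC bad; rewrite card_ord; lia.
Qed.

Lemma cabs_coords_le (R : realType) (z t : R[i]) (delta : R) :
  `|complex.Re z - complex.Re t| <= delta -> `|complex.Im z - complex.Im t| <= delta ->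
  cabs (z - t) <= 3 / 2 * delta.
Proof.
move=> hr hi; have d0 : 0 <= delta by apply: le_trans hr.
rewrite -(ler_pXn2r (_ : (0 < 2)%N)) ?nnegrE ?cabs_ge0 ?mulr_ge0 ?divr_ge0 //.
rewrite cabs_sqr !raddfB /=.
have h1 : (complex.Re z - complex.Re t) ^+ 2 <= delta ^+ 2.
  by rewrite -real_normK ?num_real // ler_sqr ?nnegrE.
have h2 : (complex.Im z - complex.Im t) ^+ 2 <= delta ^+ 2.
  by rewrite -real_normK ?num_real // ler_sqr ?nnegrE.
rewrite exprMn; have := sqr_ge0 delta; lra.
Qed.

(** An instance of [recovery_error] with [e = 3 / 2 * delta], as both coordinates of an estimate are
    [delta]-close. A dropped column is either quiet, or it wins its vote and loses against [2 * k]
    larger estimates; comparing two estimates costs [2 * e]. *)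
Lemma recovery_bound (R : realType) (m N K alpha k : nat) (M : 'M[bool]_(m, N))
    (T : 'M['I_m]_(K, N)) (x z : 'cV[R[i]]_N) (S H Z : {set 'I_N}) (yr yi : nat -> R)
    (delta : R) :
  coherent_bin K alpha M -> largest_rows M T -> (4 * (#|S| * alpha) < K)%N ->
  (#|H| <= k)%N -> (#|Z| <= 2 * k)%N ->
  delta = 16 * alpha%:R * (\sum_(j | j \notin S) cabs (x j 0)) / K%:R ->
  (forall (i : 'I_m) c, (c <= up_log 2 N)%N ->
     yr (i + m * c)%N = complex.Re (pooled M x i c) /\
     yi (i + m * c)%N = complex.Im (pooled M x i c)) ->
  let win n := (K < 2 * votes m N yr yi m n)%N in
  forall ar ai : 'I_N -> nat -> R,
  (forall n (a : 'I_K), ar n a = complex.Re (pooled M x (T a n) 0)) ->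
  (forall n (a : 'I_K), ai n a = complex.Im (pooled M x (T a n) 0)) ->
  (forall n, n \in Z -> near_median (ar n) K (complex.Re (z n 0)) /\
                        near_median (ai n) K (complex.Im (z n 0))) ->
  (forall n, n \notin Z -> z n 0 = 0) ->
  (forall n, n \notin Z -> win n -> #|Z| = (2 * k)%N /\
     exists zr zi, [/\ near_median (ar n) K zr, near_median (ai n) K zi &
       forall j, j \in Z -> zr ^+ 2 + zi ^+ 2 <= cabs (z j 0) ^+ 2]) ->
  Num.sqrt (\sum_n cabs (x n 0 - z n 0) ^+ 2) <=
    Num.sqrt (\sum_(n | n \notin H) cabs (x n 0) ^+ 2)
    + (2 + 3 / 2) * (3 / 2 * delta) * Num.sqrt k%:R.
Proof.
move=> coh TM SK Hk Zk deltaE yE win ar ai arE aiE Zmed Z0 ZN.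
have [_ _ weight _] := coh.
have d0 : 0 <= delta.
  by rewrite deltaE !mulr_ge0 ?invr_ge0 //; apply: sumr_ge0 => j _; exact: cabs_ge0.
have few n := few_noisy_rows n coh TM SK deltaE.
have close n (zr zi : R) : near_median (ar n) K zr -> near_median (ai n) K zi ->
    cabs ((zr +i* zi) - x n 0) <= 3 / 2 * delta.
  move=> mr mi; apply: cabs_coords_le => /=.
    apply: near_median_close mr (few n) _ => a; rewrite inE -leNgt => quiet.
    rewrite arE -raddfB; apply: le_trans (cabs_Re _) (le_trans _ quiet).
    exact/pooled0_near/(largest_rows_ones _ TM).
  apply: near_median_close mi (few n) _ => a; rewrite inE -leNgt => quiet.
  rewrite aiE -raddfB; apply: le_trans (cabs_Im _) (le_trans _ quiet).
  exact/pooled0_near/(largest_rows_ones _ TM).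
have closeZ n : n \in Z -> cabs (z n 0 - x n 0) <= 3 / 2 * delta.
  by move=> /Zmed[mr mi]; have := close _ _ _ mr mi; case: (z n 0).
have distC (a b : R[i]) : cabs (a - b) = cabs (b - a) by rewrite -normcN opprB.
apply: (@recovery_error _ _ _ (fun n => cabs (x n 0)) (fun n => cabs (x n 0 - z n 0)) H Z) => //.
- by rewrite !mulr_ge0.
- by move=> n; exact: cabs_ge0.
- by move=> n nZ; rewrite cabs_ge0 distC closeZ.
- by move=> n nZ; rewrite Z0 // subr0.
move=> n nZ; have [quiet|loud] := lerP (cabs (x n 0)) delta.
  by left; apply: le_trans quiet _; lra.
right; have wn : win n := votes_loud coh TM yE (few n) loud.
have [cardZ [zr [zi [mr mi zle]]]] := ZN n nZ wn; split=> // j jZ.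
have h1 := close n _ _ mr mi; have h2 := closeZ j jZ.
have h3 : cabs (zr +i* zi) <= cabs (z j 0).
  rewrite -(ler_pXn2r (_ : (0 < 2)%N)) ?nnegrE ?cabs_ge0 // cabs_sqr; exact: zle.
have h4 : cabs (x n 0) <= cabs (zr +i* zi) + cabs ((zr +i* zi) - x n 0).
  rewrite -[X in cabs X <= _](subKr (zr +i* zi)); apply: le_trans (le_normcD _ _) _.
  by rewrite normcN.
have h5 : cabs (z j 0) <= cabs (x j 0) + cabs (z j 0 - x j 0).
  rewrite -[X in cabs X <= _](addrNK (x j 0)) addrC; exact: le_normcD.
lra.
Qed.

Lemma lpnorm_sub_xopt (R : realType) (N k : nat) (x : 'cV[R[i]]_N) (i : 'I_N) :
  (x - xopt k x) i 0 = if i \in Sopt k x then 0 else x i 0.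
Proof. by rewrite !mxE; case: ifP; rewrite ?subrr ?subr0. Qed.

Lemma recover_correct (R : realType) (m N K alpha k : nat) (M : 'M[bool]_(m, N))
    (eps : R) (T : 'M['I_m]_(K, N)) :
  coherent_bin K alpha M -> 0 < eps <= 1 -> (1 <= k)%N ->
  k%:R < K%:R * (eps / (4 * alpha%:R)) -> largest_rows M T ->
  exists Delta : 'cV[R[i]]_(m * (up_log 2 N).+1) -> 'cV[R[i]]_N,
    (forall x : 'cV[R[i]]_N,
       let z := Delta (row_tensor (bin_mx R M) (bit_test R[i] N) *m x) in
       lpnorm 2 (x - z) <= lpnorm 2 (x - xopt k x)
         + 22 * eps * lpnorm 1 (x - xopt (Num.truncn (k%:R / eps)) x) / Num.sqrt k%:R) /\
    (forall y : 'cV[R[i]]_(m * (up_log 2 N).+1), exists (t : nat) (s : state R),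
       exec recover (input alpha k eps T y) t s /\
       (t <= 1000 * 1000 * (m * maxn 1 (up_log 2 N)))%N /\ output N s = Delta y).
Proof.
move=> coh /andP[eps_gt0 eps_le1] k_gt0 kK TM.
have [/andP[K_gt0 K_m] /andP[alpha_gt0 _] _ _] := coh.
have aR : (0 : R) < alpha%:R by rewrite ltr0n.
have kR : (0 : R) < k%:R by rewrite ltr0n.
have KR : (0 : R) < K%:R by rewrite ltr0n.
have kK' : 4 * alpha%:R * k%:R < K%:R * eps.
  by move: kK; rewrite mulrA ltr_pdivlMr ?mulr_gt0 // mulrC.
have k4K : (4 * k <= K)%N.
  rewrite -(ler_nat R) natrM; apply/ltW.
  apply: (@le_lt_trans _ _ (4 * alpha%:R * k%:R)).
    by rewrite -mulrA ler_pM2l // ler_peMl ?ler1n ?ltW.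
  by apply: lt_le_trans kK' _; rewrite ler_piMr // ltW.
pose k' := Num.truncn (k%:R / eps).
(* The upper limit on [k] is what makes the head of size at most [k / eps] meet fewer than K/4 rows
   of a column. *)
have SK x : (4 * (#|Sopt (R := R) k' (x : 'cV_N)| * alpha) < K)%N.
  have [/andP[/eqP cardS _] _] := SoptP k' x.
  apply: (@leq_ltn_trans (4 * (k' * alpha))); first by rewrite cardS leq_mul2l leq_mul2r geq_minl orbT.
  have k'le : k'%:R <= k%:R / eps by rewrite truncn_le // divr_ge0 ?ltW.
  rewrite -(ltr_nat R) !natrM; apply: (@le_lt_trans _ _ (4 * (k%:R / eps * alpha%:R))).
    by rewrite ler_pM2l // ler_pM2r.
  rewrite -(ltr_pM2r eps_gt0); apply: le_lt_trans kK'.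
  by rewrite le_eqVlt; apply/orP; left; apply/eqP; field; rewrite gt_eqF.
(* One output must serve every signal with the given measurements; choice then assembles [Delta]. *)
suff main : forall y : 'cV[R[i]]_(m * (up_log 2 N).+1), exists z : 'cV[R[i]]_N,
    (forall x, y = row_tensor (bin_mx R M) (bit_test R[i] N) *m x ->
       lpnorm 2 (x - z) <= lpnorm 2 (x - xopt k x)
         + 22 * eps * lpnorm 1 (x - xopt k' x) / Num.sqrt k%:R) /\
    exists (t : nat) (s : state R), exec recover (input alpha k eps T y) t s /\
       (t <= 1000 * 1000 * (m * maxn 1 (up_log 2 N)))%N /\ output N s = z.
  have [Delta DeltaP] := choice main.
  by exists Delta; split=> [x /=|y]; [apply: (DeltaP _).1|exact: (DeltaP y).2].
move=> y; have K_m' : (0 < K <= m)%N by rewrite K_gt0.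
have [t [s [e tT [Z [Zk Zin Zout Zwin]]]]] :=
  @recover_runs _ (input alpha k eps T y) m N K k erefl erefl erefl erefl
    (fun=> erefl) erefl (fun=> erefl) (fun=> erefl) K_m' k4K.
exists (output N s); split; last by exists t, s.
move=> x yE.
have measE (i : 'I_m) c : (c <= up_log 2 N)%N ->
    rmem (input alpha k eps T y) 0%N (i + m * c)%N = complex.Re (pooled M x i c) /\
    rmem (input alpha k eps T y) 1%N (i + m * c)%N = complex.Im (pooled M x i c).
  by move=> cL; rewrite yE; exact: measurementE.
pose delta := 16 * alpha%:R * (\sum_(j | j \notin Sopt k' x) cabs (x j 0)) / K%:R.
have Hk : (#|Sopt k x| <= k)%N.
  by have [/andP[/eqP -> _] _] := SoptP k x; rewrite geq_minl.
(* From [4 * alpha * k < K * eps], with [delta] containing the factor [16 * alpha / K]. *)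
have deltaK : delta * k%:R <= 4 * eps * \sum_(j | j \notin Sopt k' x) cabs (x j 0).
  rewrite /delta; set tau := \sum_(j | _) _.
  have tau0 : 0 <= tau by apply: sumr_ge0 => j _; exact: cabs_ge0.
  have -> : 16 * alpha%:R * tau / K%:R * k%:R = 4 * tau * (4 * alpha%:R * k%:R) / K%:R by ring.
  rewrite ler_pdivrMr // (_ : 4 * eps * tau * K%:R = 4 * tau * (K%:R * eps)); last by ring.
  by rewrite ler_wpM2l ?mulr_ge0 // ltW.
pose s0 := input alpha k eps T y.
pose ar (n : 'I_N) j := rmem s0 0%N (nmem s0 1%N (n * K + j)%N).
pose ai (n : 'I_N) j := rmem s0 1%N (nmem s0 1%N (n * K + j)%N).
have cellE n (a : 'I_K) : ar n a = complex.Re (pooled M x (T a n) 0) /\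
    ai n a = complex.Im (pooled M x (T a n) 0).
  have [<- <-] := measE (T a n) 0%N isT.
  by rewrite /ar /ai input_row muln0 addn0.
have outE n : output N s n 0 = rmem s 3%N n +i* rmem s 4%N n by rewrite mxE.
have := @recovery_bound _ m N K alpha k M T x (output N s) (Sopt k' x) (Sopt k x) Z
  (rmem s0 0%N) (rmem s0 1%N) delta coh TM (SK x) Hk Zk erefl measE ar ai
  (fun n a => (cellE n a).1) (fun n a => (cellE n a).2).
move=> /(_ _ _ _) bound.
have {}bound : Num.sqrt (\sum_n cabs (x n 0 - output N s n 0) ^+ 2) <=
    Num.sqrt (\sum_(n | n \notin Sopt k x) cabs (x n 0) ^+ 2)
    + (2 + 3 / 2) * (3 / 2 * delta) * Num.sqrt k%:R.
  apply: bound.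
  - by move=> n /Zin[_ mr mi]; rewrite outE.
  - by move=> n /Zout[z3 z4]; rewrite outE z3 z4.
  - move=> n nZ wn; have [cardZ [zr [zi [mr mi zle]]]] := Zwin n nZ wn.
    split=> //; exists zr, zi; split=> // j jZ.
    by rewrite cabs_sqr outE; exact: zle.
have lhsE : lpnorm 2 (x - output N s) =
    Num.sqrt (\sum_n cabs (x n 0 - output N s n 0) ^+ 2).
  by rewrite lpnorm2E; congr Num.sqrt; apply: eq_bigr => n _; rewrite !mxE.
have headE : lpnorm 2 (x - xopt k x) =
    Num.sqrt (\sum_(n | n \notin Sopt k x) cabs (x n 0) ^+ 2).
  rewrite lpnorm2E; congr Num.sqrt; rewrite [RHS]big_mkcond; apply: eq_bigr => n _.
  by rewrite lpnorm_sub_xopt; case: ifP => _; rewrite ?cabs0 ?expr0n.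
have tailE : lpnorm 1 (x - xopt k' x) = \sum_(j | j \notin Sopt k' x) cabs (x j 0).
  rewrite lpnorm1E [RHS]big_mkcond; apply: eq_bigr => n _.
  by rewrite lpnorm_sub_xopt; case: ifP => _; rewrite ?cabs0.
rewrite lhsE headE tailE; apply: le_trans bound _; rewrite lerD2l.
set tau := \sum_(j | _) _ in deltaK *.
have tau0 : 0 <= tau by apply: sumr_ge0 => j _; exact: cabs_ge0.
have sk : 0 < Num.sqrt (k%:R : R) by rewrite sqrtr_gt0.
have kE : Num.sqrt k%:R * Num.sqrt k%:R = k%:R :> R by rewrite -expr2 sqr_sqrtr.
(* The constant is 7/2 * 3/2 = 21/4; with the factor 4 of [deltaK] it becomes 21, below 22. *)
have scale (q d : R) : (2 + 3 / 2) * (3 / 2 * d) * q * q = 21 / 4 * (d * (q * q)) by field.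
rewrite ler_pdivlMr // scale kE.
have et : 0 <= eps * tau by rewrite mulr_ge0 // ltW.
clearbody tau delta; clear -deltaK et; lra.
Qed.

(** * Disjunctness, coherence and RIP *)

(** The [d] other columns cover at most [d * alpha <= K - 1] ones of a given column, which therefore
    has a row to itself. *)
Lemma coherent_disjunct (m N K alpha : nat) (M : 'M[bool]_(m, N)) :
  coherent_bin K alpha M -> disjunct ((K - 1) %/ alpha) M.
Proof.
move=> [/andP[K_gt0 _] /andP[alpha_gt0 _] weight coh] c c_inj.
set d := ((K - 1) %/ alpha)%N in c c_inj *.
have private a : exists i, M i (c a) /\ forall b, b != a -> ~~ M i (c b).
  have [//|no] := pselect (exists i, M i (c a) /\ forall b, b != a -> ~~ M i (c b)).
  have : (#|[set i | M i (c a)]| <= \sum_(b | b != a) alpha)%N.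
    apply: (@leq_trans (\sum_(b | b != a) \sum_i M i (c a) * M i (c b))); last first.
      apply: leq_sum => b ba; apply: coh; apply: contra ba => /eqP /c_inj ->; exact: eqxx.
    rewrite exchange_big cardE_sum /=; apply: leq_sum => i _.
    case Mia: (M i (c a)) => //.
    have [b ba Mib] : exists2 b, b != a & M i (c b).
      have [//|nb] := pselect (exists2 b, b != a & M i (c b)).
      case: no; exists i; split=> // b ba; apply/negP => Mib; apply: nb; by exists b.
    by rewrite (bigD1 b) //= Mib.
  rewrite sum_nat_const cardC1 card_ord => /(leq_trans (weight (c a))).
  by have := leq_trunc_div (K - 1) alpha; rewrite -/d /=; lia.
have [r rP] := choice private.
have r_id a b : M (r a) (c b) = (a == b).
  have [Ma Mb] := rP a; case: eqVneq => [<- //|ab]; apply/negbTE/Mb.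
  by rewrite eq_sym.
exists r => // a b rab; apply/eqP; have := r_id b b; rewrite -rab r_id eqxx => ->; exact.
Qed.

Lemma col_l1E (R : realType) (m N : nat) (M : 'M[bool]_(m, N)) (j : 'I_N) :
  col_l1 R M j = #|[set i | M i j]|%:R.
Proof.
rewrite /col_l1 lpnorm1E cardE_sum natr_sum; apply: eq_bigr => i _.
by rewrite !mxE; case: (M i j); rewrite ?Normc.normc1 ?cabs0.
Qed.

(** The inner product of two normalised columns is their overlap divided by the geometric mean of
    their weights, both at least [K]. *)
Lemma coherent_normalize (R : realType) (m N K alpha : nat) (M : 'M[bool]_(m, N)) :
  coherent_bin K alpha M -> coherent (alpha%:R / K%:R) (normalize_sqrt R M).
Proof.
move=> [/andP[K_gt0 _] _ weight coh].
have wK j : (K%:R : R) <= col_l1 R M j by rewrite col_l1E ler_nat.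
have KR : (0 : R) < K%:R by rewrite ltr0n.
have w_gt0 j : 0 < col_l1 R M j by exact: lt_le_trans (wK j).
split=> [j|j l jl].
  rewrite lpnorm2E (_ : \sum_i _ = 1) ?sqrtr1 //.
  rewrite (eq_bigr (fun i => (M i j)%:R / col_l1 R M j)); last first.
    move=> i _; rewrite !mxE cabs_real ger0_norm ?divr_ge0 ?sqrtr_ge0 //.
    by rewrite expr_div_n sqr_sqrtr ?ltW //; case: (M i j); rewrite ?expr1n ?expr0n.
  by rewrite -mulr_suml -natr_sum -cardE_sum -col_l1E divff // gt_eqF.
have -> : \sum_i normalize_sqrt R M i j * (normalize_sqrt R M i l)^* =
    ((\sum_i M i j * M i l)%N%:R / (Num.sqrt (col_l1 R M j) * Num.sqrt (col_l1 R M l)))%:C.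
  rewrite natr_sum mulr_suml rmorph_sum; apply: eq_bigr => i _.
  rewrite !mxE (_ : Num.conj ((_ : R)%:C : R[i]) = ((M i l)%:R / Num.sqrt (col_l1 R M l))%:C).
    by rewrite -rmorphM natrM invfM mulrACA.
  exact: conjc_real.
rewrite cabs_real ger0_norm; last by rewrite divr_ge0 ?mulr_ge0 ?sqrtr_ge0.
apply: ler_pM; rewrite ?invr_ge0 ?mulr_ge0 ?sqrtr_ge0 //; first by rewrite ler_nat coh.
rewrite lef_pV2 ?posrE ?mulr_gt0 ?sqrtr_gt0 //.
rewrite -{1}(sqr_sqrtr (ltW KR)) expr2.
by apply: ler_pM; rewrite ?sqrtr_ge0 // ler_wsqrtr.
Qed.

Lemma power_mean (R : realType) (I : finType) (A : {set I}) (u : I -> R) (p : R) :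
  1 <= p -> (forall i, 0 <= u i) ->
  (\sum_(i in A) u i) `^ p <= #|A|%:R `^ (p - 1) * \sum_(i in A) u i `^ p.
Proof.
move=> p1 u0; have p_gt0 : 0 < p by lra.
have [A0|[i0 i0A]] := set_0Vmem A.
  by rewrite A0 !big_set0 mulr0 powR0 // gt_eqF.
have aR : (0 : R) < #|A|%:R by rewrite ltr0n; apply/card_gt0P; exists i0.
have S0 : 0 <= \sum_(i in A) u i by exact: sumr_ge0.
have [->|p_ne1] := eqVneq p 1.
  rewrite subrr powRr0 mul1r powRr1 // le_eqVlt; apply/orP; left; apply/eqP.
  by apply: eq_bigr => i _; rewrite powRr1.
have p_gt1 : 0 < p - 1 by rewrite subr_gt0 lt_neqAle eq_sym p_ne1.
set a := #|A|%:R in aR *; set S := \sum_(i in A) u i in S0 *.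
pose s := S / a; have s0 : 0 <= s by rewrite divr_ge0 // ltW.
pose q := p / (p - 1).
have q_gt0 : 0 < q by rewrite divr_gt0.
have young i : u i * s `^ (p - 1) <= u i `^ p / p + s `^ p / q.
  have := @conjugate_powR R (u i) (s `^ (p - 1)) p q (u0 i) (powR_ge0 _ _) p_gt0 q_gt0.
  rewrite -powRrM (_ : (p - 1) * q = p); last by rewrite /q mulrC divfK // gt_eqF.
  apply; rewrite /q invf_div; by field; rewrite !gt_eqF.
have sumE : \sum_(i in A) (u i `^ p / p + s `^ p / q) =
    (\sum_(i in A) u i `^ p) / p + a * (s `^ p / q).
  by rewrite big_split /= -mulr_suml sumr_const /a mulr_natl.
have sE : \sum_(i in A) u i * s `^ (p - 1) = a * s `^ p.
  by rewrite -mulr_suml -/S -(mulr_powRB1 s0 p_gt0) mulrA /s [a * _]mulrC divfK // gt_eqF.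
have : a * s `^ p <= \sum_(i in A) u i `^ p.
  have := ler_sum (index_enum I) (fun i (_ : i \in A) => young i); rewrite sumE sE /q invf_div => h.
  have {}h : a * s `^ p / p <= (\sum_(i in A) u i `^ p) / p.
    have : a * (s `^ p * ((p - 1) / p)) = a * s `^ p - a * s `^ p / p.
      by by field; rewrite !gt_eqF.
    by move=> E; move: h; rewrite E; lra.
  by rewrite ler_pM2r ?invr_gt0 in h.
move=> h; have SE : S = a * s by rewrite /s mulrC divfK // gt_eqF.
have aE : a `^ p = a * a `^ (p - 1) by rewrite mulr_powRB1 // ltW.
have a0 := ltW aR; rewrite SE powRM // aE -mulrA mulrCA.
by apply: ler_wpM2l h; exact: powR_ge0.
Qed.

(** The excess is spread over the columns, each weighted by the number of others present, so that
    summing over rows yields overlaps. With two columns or more it is at least the main term, as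
    [1 <= C], and the lower bound is at most 0. *)
Lemma row_distortion (R : realType) (I : finType) (A : {set I}) (z : I -> R[i]) (p C : R) :
  1 <= p -> 1 <= C ->
  ((0 < #|A|)%N -> #|A|%:R `^ (p - 1) <= 1 + C * (#|A|%:R - 1)) ->
  (forall j, j \notin A -> z j = 0) ->
  \sum_j cabs (z j) `^ p - \sum_j C * (#|A :\ j|%:R * cabs (z j) `^ p) <= cabs (\sum_j z j) `^ p
    <= \sum_j cabs (z j) `^ p + \sum_j C * (#|A :\ j|%:R * cabs (z j) `^ p).
Proof.
move=> p1 C1 Abound zA; set B := \sum_j cabs (z j) `^ p; have p_gt0 : 0 < p by lra.
have p0 : p != 0 by rewrite gt_eqF.
have B0 : 0 <= B by apply: sumr_ge0 => j _; exact: powR_ge0.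
have -> : \sum_j C * (#|A :\ j|%:R * cabs (z j) `^ p) = C * (#|A|%:R - 1) * B.
  rewrite /B mulr_sumr; apply: eq_bigr => j _; have [jA|jA] := boolP (j \in A).
    by rewrite (cardsD1 j A) jA natrD addrAC subrr add0r mulrA.
  by rewrite zA // cabs0 powR0 // !mulr0.
have BA : B = \sum_(j in A) cabs (z j) `^ p.
  rewrite [RHS]big_mkcond; apply: eq_bigr => j _; case: ifP => // /negbT /zA ->.
  by rewrite cabs0 powR0.
have zsum : \sum_j z j = \sum_(j in A) z j.
  by rewrite [RHS]big_mkcond; apply: eq_bigr => j _; case: ifP => // /negbT /zA ->.
have [A0|A_gt0] := posnP #|A|.
  move/eqP: A0; rewrite cards_eq0 => /eqP A0.
  by rewrite BA zsum A0 !big_set0 mulr0 cabs0 powR0 // subr0 addr0 lexx.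
have upper : cabs (\sum_j z j) `^ p <= #|A|%:R `^ (p - 1) * B.
  rewrite BA zsum; apply: le_trans (power_mean A p1 (fun j => cabs_ge0 (z j))).
  apply: ge0_ler_powR; rewrite ?nnegrE ?cabs_ge0 //; [exact: ltW| |exact: cabs_sum].
  by apply: sumr_ge0 => j _; exact: cabs_ge0.
apply/andP; split; last first.
  by rewrite -[X in X + _]mul1r -mulrDl; apply: le_trans upper _; rewrite ler_wpM2r // Abound.
have [A1|A2] : #|A| = 1%N \/ (2 <= #|A|)%N by lia.
  rewrite A1 subrr mulr0 mul0r subr0.
  by move/eqP: A1 => /cards1P[j Aj]; rewrite BA zsum Aj !big_set1.
apply: (@le_trans _ _ 0); last exact: powR_ge0.
rewrite subr_le0 ler_peMl //; have : (2 : R) <= #|A|%:R by rewrite (ler_nat R 2).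
by move=> ?; nra.
Qed.

(** The condition on [a] lets one proof serve both norms: for [p = 2] it holds with [C = 1], and for
    [p] close to 1 with [C = expR 1]. *)
Lemma RIP_normalize_root (R : realType) (m N K alpha : nat) (M : 'M[bool]_(m, N))
    (p C : R) (k : nat) :
  coherent_bin K alpha M -> 1 <= p -> 1 <= C ->
  (forall a : nat, (1 <= a <= N)%N -> a%:R `^ (p - 1) <= 1 + C * (a%:R - 1)) ->
  RIP p k (C * (k%:R - 1) * alpha%:R / K%:R) (normalize_root p M).
Proof.
move=> [/andP[K_gt0 _] _ weight coh] p1 C1 aC x xk.
have p_gt0 : 0 < p by lra.
have p0 : p != 0 by rewrite gt_eqF.
have KR : (0 : R) < K%:R by rewrite ltr0n.
have wK j : (K%:R : R) <= col_l1 R M j by rewrite col_l1E ler_nat.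
have w_gt0 j : 0 < col_l1 R M j by exact: lt_le_trans (wK j).
set W := normalize_root p M; pose S := [set j | x j 0 != 0].
pose A i := [set j in S | M i j].
pose z i j := W i j * x j 0.
have zA i j : j \notin A i -> z i j = 0.
  rewrite !inE negb_and negbK /z => /orP[/eqP->|/negPf Mij]; first by rewrite mulr0.
  by rewrite mxE Mij mul0r mul0r.
have zp i j : cabs (z i j) `^ p = (M i j)%:R * (cabs (x j 0) `^ p / col_l1 R M j).
  rewrite /z mxE Normc.normcM cabs_real; case: (M i j); last first.
    by rewrite !mul0r normr0 mul0r powR0.
  rewrite !mul1r ger0_norm ?invr_ge0 ?powR_ge0 // powRM ?cabs_ge0 ?invr_ge0 ?powR_ge0 //.
  by rewrite -powRN -powRrM mulNr mulVf // powR_inv1 ?ltW // mulrC.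
have total : \sum_i \sum_j cabs (z i j) `^ p = \sum_j cabs (x j 0) `^ p.
  rewrite exchange_big; apply: eq_bigr => j _.
  rewrite (eq_bigr _ (fun i _ => zp i j)) -mulr_suml -natr_sum -cardE_sum -col_l1E.
  by rewrite mulrCA divff ?mulr1 // gt_eqF.
set eps := C * (k%:R - 1) * alpha%:R / K%:R.
have excess : \sum_i \sum_j C * (#|A i :\ j|%:R * cabs (z i j) `^ p) <=
    eps * \sum_j cabs (x j 0) `^ p.
  rewrite exchange_big mulr_sumr; apply: ler_sum => j _.
  (* For [k = 0] the factor [k%:R - 1] is negative; only a nonzero coordinate ensures [0 < k]. *)
  have [xj|xj] := eqVneq (x j 0) 0.
    rewrite xj cabs0 powR0 // mulr0 big1 // => i _.
    by rewrite zp xj cabs0 powR0 // mul0r !mulr0.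
  have jS : j \in S by rewrite inE.
  rewrite -mulr_sumr (eq_bigr (fun i =>
    (#|A i :\ j| * M i j)%:R * (cabs (x j 0) `^ p / col_l1 R M j))); last first.
    by move=> i _; rewrite zp natrM mulrA.
  rewrite -mulr_suml -natr_sum.
  (* The sum counts the overlaps of column [j] with the at most [k - 1] other columns of the
     support. *)
  have count : (\sum_i #|A i :\ j| * M i j <= (k - 1) * alpha)%N.
    apply: (@leq_trans (\sum_(l in S :\ j) \sum_i M i j * M i l)).
      rewrite exchange_big; apply: leq_sum => i _ /=; case: (M i j); last by rewrite muln0.
      rewrite muln1 -sum1_card (eq_bigl (fun l => (l \in S :\ j) && M i l)); last first.
        by move=> l; rewrite !inE andbA.
      rewrite big_mkcondr; apply: leq_sum => l _; by case: (M i l).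
    apply: (@leq_trans (\sum_(l in S :\ j) alpha)).
      by apply: leq_sum => l; rewrite !inE => /andP[lj _]; apply: coh; rewrite eq_sym.
    rewrite sum_nat_const leq_mul2r; apply/orP; right.
    by have := cardsD1 j S; rewrite jS; move: xk; rewrite /nnz -/S; lia.
  have k_gt0 : (0 < k)%N by apply: leq_trans xk; apply/card_gt0P; exists j.
  have xp0 : 0 <= cabs (x j 0) `^ p by exact: powR_ge0.
  have h1 : (\sum_i #|A i :\ j| * M i j)%:R <= (k%:R - 1) * alpha%:R :> R.
    by rewrite -(natrB _ k_gt0) -natrM ler_nat.
  have h2 : cabs (x j 0) `^ p / col_l1 R M j <= cabs (x j 0) `^ p / K%:R.
    by rewrite ler_wpM2l // lef_pV2 ?posrE.
  have h3 : (0 : R) <= (\sum_i #|A i :\ j| * M i j)%:R by rewrite ler0n.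
  have h4 : 0 <= cabs (x j 0) `^ p / col_l1 R M j by rewrite divr_ge0 // ltW.
  have := ler_pM h3 h4 h1 h2; rewrite /eps => h.
  have -> : C * (k%:R - 1) * alpha%:R / K%:R * cabs (x j 0) `^ p =
     C * ((k%:R - 1) * alpha%:R * (cabs (x j 0) `^ p / K%:R)) by ring.
  by rewrite ler_wpM2l //; lra.
have Wx i : (W *m x) i 0 = \sum_j z i j by rewrite mxE.
rewrite !lpnorm_powR // mulrBl mulrDl mul1r.
have row i := @row_distortion R _ (A i) (z i) p C p1 C1.
have rows i : \sum_j cabs (z i j) `^ p - \sum_j C * (#|A i :\ j|%:R * cabs (z i j) `^ p)
    <= cabs ((W *m x) i 0) `^ p
    <= \sum_j cabs (z i j) `^ p + \sum_j C * (#|A i :\ j|%:R * cabs (z i j) `^ p).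
  rewrite Wx; apply: row; last exact: zA.
  by move=> A_gt0; apply: aC; rewrite A_gt0 /=; have := max_card (mem (A i)); rewrite card_ord.
rewrite -total; have {}rows i := andP (rows i).
apply/andP; split.
  apply: le_trans (ler_sum _ (fun i _ => (rows i).1)); rewrite sumrB total.
  by rewrite lerD2l lerN2.
apply: (le_trans (ler_sum _ (fun i _ => (rows i).2))); rewrite big_split /= total.
by rewrite lerD2l.
Qed.

Lemma normalize_root2 (R : realType) (m N : nat) (M : 'M[bool]_(m, N)) :
  normalize_root 2 M = normalize_sqrt R M.
Proof.
apply/matrixP => i j; rewrite !mxE powR12_sqrt // col_l1E ler0n //.
Qed.

Lemma RIP2_normalize_sqrt (R : realType) (m N K alpha : nat) (M : 'M[bool]_(m, N)) (k : nat) :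
  coherent_bin K alpha M ->
  RIP 2 k ((k%:R - 1) * alpha%:R / K%:R) (normalize_sqrt R M).
Proof.
move=> coh; rewrite -normalize_root2 -[k%:R - 1]mul1r.
apply: RIP_normalize_root => //; first by rewrite ler1n.
move=> a _; rewrite (_ : 2 - 1 = 1 :> R); last by lra.
by rewrite powRr1 // mul1r addrC subrK.
Qed.

(** For [a >= 2] the power is at most N^(1 / ln N) = e, and [a - 1 >= 1]; for [a = 1] both sides are
    1. *)
Lemma powR_le_expR1 (R : realType) (N a : nat) (p : R) :
  ((1 < N)%N -> p <= 1 + 1 / ln N%:R) -> 1 <= p -> (1 <= a <= N)%N ->
  a%:R `^ (p - 1) <= 1 + expR 1 * (a%:R - 1).
Proof.
move=> pN p1 /andP[a_gt0 aN]; have e1 : (1 : R) <= expR 1 by rewrite -expR0 ler_expR.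
have [->|a_ne1] := eqVneq a 1%N; first by rewrite powR1 subrr mulr0 addr0.
have a2 : (2 <= a)%N by lia.
have aR : (2 : R) <= a%:R by rewrite (ler_nat R 2).
have N_gt1 : (1 < N)%N by apply: leq_trans aN.
have NR : (1 : R) < N%:R by rewrite (ltr_nat R 1).
have lnN : 0 < ln (N%:R : R) by rewrite ln_gt0.
have h : a%:R `^ (p - 1) <= expR 1 :> R.
  apply: (@le_trans _ _ (N%:R `^ (p - 1))).
    by apply: ge0_ler_powR; rewrite ?nnegrE ?ler0n ?ler_nat // subr_ge0.
  rewrite /powR gt_eqF; last by apply: lt_trans NR.
  rewrite ler_expR -ler_pdivlMr //; have := pN N_gt1; lra.
apply: le_trans h _; have : expR 1 * 1 <= expR 1 * (a%:R - 1) :> R.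
  by rewrite ler_wpM2l ?expR_ge0 //; lra.
lra.
Qed.

(** * Number of rows *)

(** A row meeting [d] of the columns satisfies [d <= 1 + d * (d - 1)]; summed over rows, the last
    term counts overlaps of ordered pairs. *)
Lemma rows_of_columns (m N K alpha n : nat) (M : 'M[bool]_(m, N)) :
  coherent_bin K alpha M -> (n <= N)%N -> (n * K <= m + n * ((n - 1) * alpha))%N.
Proof.
move=> [_ _ weight coh] nN; pose c (j : 'I_n) := widen_ord nN j.
have c_inj : injective c by move=> a b /(congr1 val) /= ab; exact: val_inj.
apply: (@leq_trans (\sum_(j < n) \sum_i M i (c j))).
  rewrite -[X in (X * _)%N]card_ord -sum_nat_const; apply: leq_sum => j _.
  by rewrite -cardE_sum.
rewrite exchange_big /=.
apply: (@leq_trans (\sum_(i < m) (1 + \sum_(j < n) \sum_(l < n | l != j) M i (c j) * M i (c l)))).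
  apply: leq_sum => i _; set d := (\sum_(j < n) M i (c j))%N.
  have -> : (\sum_(j < n) \sum_(l < n | l != j) M i (c j) * M i (c l) = d * (d - 1))%N.
    rewrite {1}/d big_distrl; apply: eq_bigr => j _; rewrite -big_distrr /=.
    have -> : d = (M i (c j) + \sum_(l < n | l != j) M i (c l))%N by rewrite /d (bigD1 j).
    by case: (M i (c j)); rewrite ?mul0n // addKn.
  by nia.
rewrite big_split /= sum_nat_const card_ord muln1 leq_add2l exchange_big /=.
rewrite -[X in (_ <= X * _)%N]card_ord -sum_nat_const; apply: leq_sum => j _.
rewrite exchange_big /=; apply: (@leq_trans (\sum_(l < n | l != j) alpha)).
  by apply: leq_sum => l lj; apply: coh; apply: contra lj => /eqP /c_inj ->.
by rewrite sum_nat_const cardC1 card_ord subn1.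
Qed.

(** Take n = K %/ (2 alpha) + 1 columns. Overlaps absorb at most half of [n * K], while [n * K]
    exceeds K^2 / (2 alpha). The hypothesis provides that many columns. *)
Lemma weight_sqr_le (m N K alpha : nat) (M : 'M[bool]_(m, N)) :
  coherent_bin K alpha M -> (K < N * alpha)%N -> (K * K <= 4 * (alpha * m))%N.
Proof.
move=> coh KN; have [/andP[K_gt0 _] /andP[alpha_gt0 _] _ _] := coh.
pose n := (K %/ (2 * alpha)).+1.
have a2 : (0 < 2 * alpha)%N by lia.
have lo : (K %/ (2 * alpha) * (2 * alpha) <= K)%N := leq_trunc_div _ _.
have hi : (K < n * (2 * alpha))%N by rewrite -ltn_divLR.
have nN : (n <= N)%N.
  by rewrite /n ltn_divLR //; apply: leq_trans KN _; rewrite leq_mul2l leq_pmull ?orbT.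
have := rows_of_columns coh nN; rewrite {2}/n subn1 /=.
move: lo hi; set q := (K %/ _)%N => lo hi h.
have h1 := leq_mul (leqnn n) lo.
have h2 := leq_mul (ltnW hi) (leqnn K).
have h3 : (n * K <= 2 * m)%N by rewrite -/n in h; nia.
nia.
Qed.

(** No set of [alpha + 1] rows lies in two distinct columns, so the families of such subsets are
    disjoint. *)
Lemma packing (m N K alpha : nat) (M : 'M[bool]_(m, N)) :
  coherent_bin K alpha M -> (N * 'C(K, alpha.+1) <= 'C(m, alpha.+1))%N.
Proof.
move=> [_ _ weight coh].
pose D (j : 'I_N) := [set B : {set 'I_m} | (B \subset [set i | M i j]) && (#|B| == alpha.+1)].
have cardD j : ('C(K, alpha.+1) <= #|D j|)%N by rewrite cards_draws leq_bin2l.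
apply: (@leq_trans (\sum_j #|D j|)).
  rewrite -[X in (X * _)%N]card_ord -sum_nat_const; exact: leq_sum.
have -> : 'C(m, alpha.+1) = #|[set B : {set 'I_m} | #|B| == alpha.+1]|.
  by rewrite card_draws card_ord.
under eq_bigr do rewrite cardE_sum.
rewrite exchange_big cardE_sum /=; apply: leq_sum => B _.
case: (#|B| =P alpha.+1) => cardB; last by rewrite big1 // => j _; rewrite andbF.
under eq_bigr do rewrite andbT.
rewrite -cardE_sum; apply/card_le1_eqP => j l; rewrite !inE => Bj Bl.
apply/eqP/negPn/negP => jl; have := coh j l _.
rewrite eq_sym jl => /(_ isT); rewrite leqNgt => /negP[].
have -> : (\sum_i M i j * M i l)%N = #|[set i | M i j && M i l]|.
  by rewrite cardE_sum; apply: eq_bigr => i _; case: (M i j); rewrite ?mul1n ?mul0n.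
rewrite -cardB; apply/subset_leq_card/fintype.subsetP => i iB.
by have := fintype.subsetP Bj i iB; have := fintype.subsetP Bl i iB; rewrite !inE => -> ->.
Qed.

(** After clearing the factorial, the factors of the falling factorial of [K] are at least
    [K - alpha] and those of [m] at most [m]. *)
Lemma packing_exp (m N K alpha : nat) (M : 'M[bool]_(m, N)) :
  coherent_bin K alpha M -> (N * (K - alpha) ^ alpha.+1 <= m ^ alpha.+1)%N.
Proof.
move=> coh; have := packing coh.
rewrite -(leq_pmul2r (fact_gt0 alpha.+1)) -mulnA !bin_ffact => h.
apply: (@leq_trans (N * K ^_ alpha.+1)).
  rewrite leq_mul2l ffact_prod -[X in (_ ^ X)%N]card_ord -prod_nat_const.
  by apply/orP; right; apply: leq_prod => i _; have := ltn_ord i; lia.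
apply: leq_trans h _; rewrite ffact_prod -[X in (_ ^ X)%N]card_ord -prod_nat_const.
by apply: leq_prod => i _; exact: leq_subr.
Qed.

(* If [m] is too small, [y = ln N / (alpha ln (K / alpha))] satisfies [y > 1 / (4 w)] by
   covering and [(y - 2) ln r <= 2 ln y] by packing; the three bounds on [w] make these
   incompatible. *)
Definition row_const (R : realType) (r : R) : R :=
  Num.min (1 / 16) (Num.min (1 - r^-1) (ln r ^+ 2 / 256)).

Lemma row_const_gt0 (R : realType) (r : R) : 1 < r -> 0 < row_const r.
Proof.
move=> r1; have r0 : 0 < r by lra.
have l0 : 0 < ln r ^+ 2 by rewrite exprn_gt0 ?ln_gt0.
rewrite !lt_min subr_gt0 invf_lt1 // r1; apply/andP; split; first by lra.
by lra.
Qed.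

Lemma ln_lt_2sqrt (R : realType) (y : R) : 0 < y -> ln y < 2 * Num.sqrt y.
Proof.
move=> y0; have sy : 0 < Num.sqrt y by rewrite sqrtr_gt0.
rewrite -[X in ln X](sqr_sqrtr (ltW y0)) lnXn // mulr2n.
by have := ln_sublinear sy; lra.
Qed.

Lemma row_count (R : realType) (m N K alpha : nat) (M : 'M[bool]_(m, N)) (r : R) :
  coherent_bin K alpha M -> 1 < r -> r <= K%:R / alpha%:R ->
  row_const r * Num.min ((K%:R ^+ 2 / alpha%:R ^+ 2) * (ln N%:R / ln (K%:R / alpha%:R))) N%:R
    <= m%:R.
Proof.
move=> coh r1 rK; have [/andP[K_gt0 Km] /andP[alpha_gt0 _] _ _] := coh.
have w_gt0 := row_const_gt0 r1; set w := row_const r in w_gt0 *.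
have w16 : w <= 1 / 16 by rewrite /w /row_const ge_min lexx.
have wc : w <= 1 - r^-1 by rewrite /w /row_const !ge_min lexx !orbT.
have wg : w <= ln r ^+ 2 / 256 by rewrite /w /row_const !ge_min lexx !orbT.
have r0 : 0 < r by lra.
have aR : (0 : R) < alpha%:R by rewrite ltr0n.
have KR : (0 : R) < K%:R by rewrite ltr0n.
have mR : (0 : R) < m%:R by rewrite ltr0n (leq_trans K_gt0).
(* With so few columns [N <= K <= m], and the minimum is bounded by [N]. *)
have [KN|KN] := leqP (N * alpha) K.
  have Nm : (N <= m)%N by apply: leq_trans Km; apply: leq_trans KN; rewrite leq_pmulr.
  apply: (@le_trans _ _ (w * N%:R)); first by rewrite ler_pM2l // ge_min lexx orbT.
  apply: (@le_trans _ _ (1 * N%:R)); first by rewrite ler_wpM2r //; lra.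
  by rewrite mul1r ler_nat.
have N_gt0 : (0 < N)%N by case: (N) KN => //; rewrite mul0n.
set rho := K%:R / alpha%:R in rK *; set L := ln N%:R / ln rho.
have rho1 : 1 < rho by lra.
have rho0 : 0 < rho by lra.
have lnrho : 0 < ln rho by rewrite ln_gt0.
have lnr : 0 < ln r by rewrite ln_gt0.
have lnr_rho : ln r <= ln rho by rewrite ler_ln ?posrE //; lra.
have -> : K%:R ^+ 2 / alpha%:R ^+ 2 = rho ^+ 2 by rewrite expr_div_n.
apply: (@le_trans _ _ (w * (rho ^+ 2 * L))); first by rewrite ler_pM2l // ge_min lexx.
rewrite leNgt; apply/negP => m_small.
pose y := L / alpha%:R.
have KaE : K%:R = rho * alpha%:R by rewrite /rho divfK // gt_eqF.
have LE : L = y * alpha%:R by rewrite /y divfK // gt_eqF.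
(* Covering gives [K * K <= 4 * (alpha * m)], and the assumed smallness of [m] turns the right side
   into less than [4 * w * y * (K * K)]. *)
have y_big : 1 < 4 * w * y.
  have : (K * K)%:R <= (4 * (alpha * m))%:R :> R by rewrite ler_nat; exact: weight_sqr_le coh KN.
  rewrite !natrM => h.
  have {}h : K%:R * K%:R < 4 * (alpha%:R * (w * (rho ^+ 2 * L))).
    by apply: le_lt_trans h _; rewrite ltr_pM2l // ltr_pM2l.
  have : 1 * (K%:R * K%:R) < 4 * w * y * (K%:R * K%:R).
    rewrite mul1r; apply: lt_le_trans h _; rewrite LE KaE le_eqVlt; apply/orP; left.
    by apply/eqP; ring.
  by rewrite ltr_pM2r // mulr_gt0.
have y_gt0 : 0 < y.
  have w4 : 0 < 4 * w by rewrite mulr_gt0.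
  by rewrite -(pmulr_rgt0 _ w4); lra.
have y4 : 4 < y.
  have : 4 * w * y <= 1 / 4 * y by rewrite ler_pM2r //; lra.
  lra.
have aK : (alpha < K)%N.
  by move: rho1; rewrite /rho ltr_pdivlMr // mul1r ltr_nat.
have Ka : (1 - r^-1) * K%:R <= (K - alpha)%:R.
  rewrite natrB ?(ltnW aK) // mulrBl mul1r lerD2l lerN2 ler_pdivlMl //.
  by move: rK; rewrite /rho ler_pdivlMr.
have KaR : (0 : R) < (K - alpha)%:R by rewrite ltr0n subn_gt0.
have NR : (0 : R) < N%:R by rewrite ltr0n.
have pack : N%:R <= (m%:R / (K - alpha)%:R) ^+ alpha.+1 :> R.
  rewrite expr_div_n ler_pdivlMr ?exprn_gt0 // -!natrX -natrM ler_nat.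
  exact: packing_exp coh.
have c_gt0 : 0 < 1 - r^-1 by lra.
(* Here [w <= 1 - r^-1] offsets the loss from [K] to [K - alpha]. *)
have ratio : m%:R / (K - alpha)%:R <= rho * y.
  rewrite ler_pdivrMr //; apply: (@le_trans _ _ (w * (rho ^+ 2 * L))); first exact: ltW.
  apply: (@le_trans _ _ (rho * y * ((1 - r^-1) * K%:R))); last first.
    by rewrite ler_pM2l // mulr_gt0.
  rewrite LE KaE.
  rewrite (_ : w * (rho ^+ 2 * (y * alpha%:R)) = rho * y * (w * (rho * alpha%:R))); last by ring.
  apply: ler_wpM2l; first exact/ltW/mulr_gt0.
  by apply: ler_wpM2r wc; exact/ltW/mulr_gt0.
(* Logarithm of the packing bound; [alpha + 1 <= 2 * alpha] makes [alpha] cancel. *)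
have ln_bound : y * ln rho <= 2 * (ln rho + ln y).
  have h1 : ln N%:R <= alpha.+1%:R * (ln rho + ln y).
    have ry : 0 < rho * y by exact: mulr_gt0.
    have -> : alpha.+1%:R * (ln rho + ln y) = ln ((rho * y) ^+ alpha.+1).
      by rewrite -lnM ?posrE // lnXn // mulr_natl.
    rewrite ler_ln ?posrE ?exprn_gt0 //; apply: le_trans pack _.
    by apply: lerXn2r; rewrite ?nnegrE ?divr_ge0 //; exact: ltW.
  have lny : 0 < ln y by rewrite ln_gt0 //; lra.
  have ly : 0 <= ln rho + ln y by rewrite addr_ge0 // ltW.
  have h2 : alpha.+1%:R <= 2 * alpha%:R :> R.
    by rewrite -[leRHS](natrM R 2 alpha) ler_nat mul2n -addnn -addn1 leq_add2l.
  have h3 : ln N%:R = y * ln rho * alpha%:R.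
    by rewrite mulrAC -LE /L divfK // gt_eqF.
  have := ler_wpM2r ly h2 => h4.
  have : y * ln rho * alpha%:R <= 2 * (ln rho + ln y) * alpha%:R.
    rewrite -h3; apply: le_trans h1 _; apply: le_trans h4 _; rewrite le_eqVlt.
    by apply/orP; left; apply/eqP; ring.
  by rewrite ler_pM2r.
have sy := ln_lt_2sqrt y_gt0.
have s0 : 0 < Num.sqrt y by rewrite sqrtr_gt0.
have sE : Num.sqrt y * Num.sqrt y = y by rewrite -expr2 sqr_sqrtr // ltW.
(* As [4 < y], [y / 2] is below [y - 2]. *)
have half : y / 2 * ln r <= 2 * ln y.
  have : y / 2 * ln r <= (y - 2) * ln rho by apply: ler_pM => //; lra.
  by lra.
have s_small : Num.sqrt y * ln r < 8.
  rewrite -(ltr_pM2l s0) mulrA sE; lra.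
(* Together with [w <= ln r ^+ 2 / 256] this gives [4 * w * y < 1], against [y_big]. *)
have : y * ln r ^+ 2 < 64.
  have -> : y * ln r ^+ 2 = (Num.sqrt y * ln r) ^+ 2 by rewrite exprMn sqr_sqrtr // ltW.
  rewrite (_ : 64 = 8 ^+ 2); last by ring.
  by rewrite ltr_pXn2r ?nnegrE // mulr_ge0 // ltW.
have : w * y <= ln r ^+ 2 / 256 * y by rewrite ler_pM2r.
lra.
Qed.

(** Program and constants are chosen before the instance, so the asymptotic bounds are uniform. The
    constant of item 6 depends on a lower bound [r > 1] for [K / alpha], since the logarithm to that
    base blows up as the base tends to 1. *)
Theorem theorem4 (R : realType) :
  exists (P : cmd) (c : nat) (C : R) (w : R -> R),
    1 / 2 < C /\
    (forall r : R, 1 < r -> 0 < w r) /\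
    forall (m N K alpha : nat) (M : 'M[bool]_(m, N)),
      coherent_bin K alpha M ->
      (* 1 *)
      (forall (eps : R) (k : nat),
         0 < eps <= 1 ->
         (1 <= k)%N -> k%:R < K%:R * (eps / (4 * alpha%:R)) ->
         forall T : 'M['I_m]_(K, N), largest_rows M T ->
         exists Delta : 'cV[R[i]]_(m * (up_log 2 N).+1) -> 'cV[R[i]]_N,
           (forall x : 'cV[R[i]]_N,
              let z := Delta (row_tensor (bin_mx R M) (bit_test R[i] N) *m x) in
              lpnorm 2 (x - z) <=
                lpnorm 2 (x - xopt k x)
                + 22 * eps * lpnorm 1 (x - xopt (Num.truncn (k%:R / eps)) x)
                  / Num.sqrt k%:R) /\
           (forall y : 'cV[R[i]]_(m * (up_log 2 N).+1),
              exists (t : nat) (s : state R),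
                exec P (input alpha k eps T y) t s /\
                (t <= c * (m * maxn 1 (up_log 2 N)))%N /\
                output N s = Delta y)) /\
      (* 2 *)
      coherent (alpha%:R / K%:R) (normalize_sqrt R M) /\
      (* 3 *)
      (forall k : nat,
         RIP 2 k ((k%:R - 1) * alpha%:R / K%:R) (normalize_sqrt R M)) /\
      (* 4 *)
      (forall (k : nat) (p : R),
         1 <= p -> ((1 < N)%N -> p <= 1 + 1 / ln N%:R) ->
         RIP p k (C * (k%:R - 1) * alpha%:R / K%:R) (normalize_root p M)) /\
      (* 5 *)
      disjunct ((K - 1) %/ alpha) M /\
      (* 6 *)
      (forall r : R, 1 < r -> r <= K%:R / alpha%:R ->
         w r * Num.min ((K%:R ^+ 2 / alpha%:R ^+ 2)
                        * (ln N%:R / ln (K%:R / alpha%:R))) N%:R <= m%:R).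
Proof.
(* The constant of item 4 is e, the value of N^(1 / ln N). *)
exists recover, (1000 * 1000)%N, (expR 1), (@row_const R).
have e1 : (1 : R) <= expR 1 by rewrite -expR0 ler_expR.
split; first by lra.
split; first exact: row_const_gt0.
move=> m N K alpha M coh; split.
  by move=> eps k eps01 k1 kK T TM; exact: recover_correct.
split; first exact: coherent_normalize.
split; first by move=> k; exact: RIP2_normalize_sqrt.
split.
  move=> k p p1 pN; apply: RIP_normalize_root => // a aN.
  exact: powR_le_expR1 aN.
split; first exact: coherent_disjunct.
by move=> r r1 rK; exact: row_count coh r1 rK.
Qed.
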